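(* For any integer $N\geq 2$, if the random configuration $(x_1,\ldots,x_N)$ on $\mathbb{S}$ has for distribution the Coulomb gas $\mathbb{P}_{N,N}$ at inverse temperature $\beta=N$, then $$\mathscr{H}_N(x_1,\ldots,x_N)-\min_{\mathbb{S}^N}\mathscr{H}_N\leq 10\log N$$ with probability at least $1-\mathrm{e}^{-N\log N}$. Moreover, $$\mathbb{E}_{N}\big[\mathscr{H}_N(x_1,\ldots,x_N)\big]-\min_{\mathbb{S}^N}\mathscr{H}_N\leq 9\log N.$$
   Context: Let $\|\cdot\|$ be the Euclidean norm on $\mathbb{R}^3$ and $\mathbb{S}:=\{x\in\mathbb{R}^3:\|x\|=1\}$ the unit sphere. For $N\geq 2$, the logarithmic energy of a configuration $x=(x_1,\ldots,x_N)\in\mathbb{S}^N$ is $$\mathscr{H}_N(x)=\mathscr{H}_N(x_1,\ldots,x_N):=\sum_{i\neq j}\log\frac{1}{\|x_i-x_j\|},$$ where the sum is over all ordered pairs $(i,j)$ with $1\leq i,j\leq N$ and $i\neq j$, with value $+\infty$ if two of the points coincide. Let $\sigma$ be the uniform measure on $\mathbb{S}$ normalized so that $\sigma(\mathbb{S})=1$, i.e. $\sigma=(4\pi)^{-1}\mathrm{Vol}$ (surface measure divided by $4\pi$). For $N\geq 2$ and $\beta>0$, the Coulomb gas at inverse temperature $\beta$ is the probability measure on $\mathbb{S}^N$ $$\mathbb{P}_{N,\beta}(\mathrm{d}x):=\frac{1}{Z_{N,\beta}}\,\mathrm{e}^{-\beta\mathscr{H}_N(x)}\,\sigma^{\otimes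 N}(\mathrm{d}x),\qquad Z_{N,\beta}:=\int_{\mathbb{S}^N}\mathrm{e}^{-\beta\mathscr{H}_N(x)}\,\sigma^{\otimes N}(\mathrm{d}x),$$ with the convention $\mathrm{e}^{-\infty}=0$. $\mathbb{E}_\beta$ denotes expectation with respect to $\mathbb{P}_{N,\beta}$; in particular $\mathbb{E}_N$ is expectation with respect to $\mathbb{P}_{N,N}$. *)

(* Defs.v *)
From HB Require Import structures.
From mathcomp Require Import all_boot all_order all_algebra.
From mathcomp Require Import all_classical all_reals all_analysis.
From mathcomp Require Import measurable_realfun.

Set Implicit Arguments.
Unset Strict Implicit.
Unset Printing Implicit Defensive.

Import Order.TTheory GRing.Theory Num.Theory.
Import numFieldNormedType.Exports.

Local Open Scope classical_set_scope.
Local Open Scope ring_scope.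

(* Euclidean 3-space as a type carrying the product Borel sigma-algebra (row
   vectors have no measurable structure in the library, and their norm there
   is the sup norm). *)
Notation R3 R := (3.-tuple (measurableTypeR R)).

Section euclidean_space.
Context {R : realType}.

Definition sub3 (x y : R3 R) : R3 R := [tuple tnth x k - tnth y k | k < 3].

Definition norm3 (x : R3 R) : R := Num.sqrt (\sum_(k < 3) tnth x k ^+ 2).

Definition sphere : set (R3 R) := [set x | norm3 x = 1].

Definition sphereN (N : nat) : set (N.-tuple (R3 R)) :=
  [set x | forall i, sphere (tnth x i)].

Definition is_minimum (T : Type) (A : set T) (f : T -> \bar R) (m : \bar R) :=
  (exists2 x, A x & f x = m) /\ (forall x, A x -> m <= f x)%E.

End euclidean_space.
Arguments sphereN R N : clear implicits.

Section integral_over_preimage.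
Context d1 d2 (T1 : measurableType d1) (T2 : measurableType d2) (R : realType).
Variable mu : {measure set T1 -> \bar R}.

Lemma semi_sigma_additive_integral_preimage (D : set T1) (p : T1 -> T2)
    (f : T1 -> \bar R) :
  measurable D -> measurable_fun setT p -> measurable_fun D f ->
  (forall t, D t -> 0 <= f t)%E ->
  semi_sigma_additive (fun A => \int[mu]_(t in D `&` p @^-1` A) f t)%E.
Proof.
move=> mD mp mf f0 /= F mF tF mUF.
have mpF n : measurable (D `&` p @^-1` F n).
  by apply: measurableI => //; rewrite -[X in measurable X]setTI; exact: mp.
rewrite preimage_bigcup setI_bigcupr ge0_integral_bigcup//=.
- apply: is_cvg_ereal_nneg_natsum_cond => n _ _.
  by apply: integral_ge0 => t [Dt _]; exact: f0.
- by apply: measurable_funS mf => // t [n _ []].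
- by move=> t [n _ [Dt _]]; exact: f0.
- apply/trivIsetP => i j _ _ ij.
  move/trivIsetP : tF => /(_ i j Logic.I Logic.I ij) Fij.
  by rewrite setIACA setIid -preimage_setI Fij preimage_set0 setI0.
Qed.

End integral_over_preimage.

Section surface_measure.
Context {R : realType}.
Local Open Scope ereal_scope.

(* Colatitude theta in [0, pi], longitude phi in [0, 2 pi]; the area element
   is sin theta dtheta dphi. *)
Definition spherical_coord (t : measurableTypeR R * measurableTypeR R) : R3 R :=
  [tuple sin t.1 * cos t.2; sin t.1 * sin t.2; cos t.1]%R.

Definition spherical_dom : set (measurableTypeR R * measurableTypeR R) :=
  `[0%R, pi] `*` `[0%R, (2 * pi)%R].

Definition surface_measure (A : set (R3 R)) : \bar R :=
  \int[lebesgue_measure \x lebesgue_measure]_(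
      t in spherical_dom `&` spherical_coord @^-1` A) (sin t.1)%:E.

Lemma measurable_spherical_dom : measurable spherical_dom.
Proof. by apply: measurableX; exact: measurable_itv. Qed.

Lemma measurable_spherical_coord : measurable_fun setT spherical_coord.
Proof.
have ms : measurable_fun setT (@sin R).
  by apply: continuous_measurable_fun; exact: continuous_sin.
have mc : measurable_fun setT (@cos R).
  by apply: continuous_measurable_fun; exact: continuous_cos.
have m1 := @measurable_fst _ _ (measurableTypeR R) (measurableTypeR R).
have m2 := @measurable_snd _ _ (measurableTypeR R) (measurableTypeR R).
apply/measurable_fun_tnthP => -[[|[|[|//]]] i3].
- rewrite (_ : _ \o _ = fun t => (sin t.1 * cos t.2)%R)//.
  by apply: measurable_funM; exact: measurableT_comp.
- rewrite (_ : _ \o _ = fun t => (sin t.1 * sin t.2)%R)//.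
  by apply: measurable_funM; exact: measurableT_comp.
- rewrite (_ : _ \o _ = fun t => cos t.1)//.
  exact: measurableT_comp.
Qed.

Lemma sin_spherical_dom_ge0 t : spherical_dom t -> 0 <= (sin t.1)%:E.
Proof. by case=> + _; rewrite lee_fin => /sin_ge0_pi. Qed.

Lemma measurable_sin_fst :
  measurable_fun setT
    (fun t : measurableTypeR R * measurableTypeR R => (sin t.1)%:E).
Proof.
apply/measurable_EFinP; apply: (@measurableT_comp _ _ _ _ _ _ (@sin R)) => //.
by apply: continuous_measurable_fun; exact: continuous_sin.
Qed.

Let surface_measure0 : surface_measure set0 = 0.
Proof. by rewrite /surface_measure preimage_set0 setI0 integral_set0. Qed.

Let surface_measure_ge0 A : 0 <= surface_measure A.
Proof. by apply: integral_ge0 => t [+ _]; exact: sin_spherical_dom_ge0. Qed.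

Let surface_measure_sigma_additive : semi_sigma_additive surface_measure.
Proof.
apply: semi_sigma_additive_integral_preimage.
- exact: measurable_spherical_dom.
- exact: measurable_spherical_coord.
- by apply: measurable_funTS; exact: measurable_sin_fst.
- exact: sin_spherical_dom_ge0.
Qed.

HB.instance Definition _ := isMeasure.Build _ _ _ surface_measure
  surface_measure0 surface_measure_ge0 surface_measure_sigma_additive.

Let integral_sin : \int[lebesgue_measure]_(x in `[0%R, pi]) (sin x)%:E = 2%:E
  :> \bar R.
Proof.
have dmcos (x : R) : is_derive x 1%R (fun y => - cos y)%R (sin x).
  have -> : (fun y : R => - cos y)%R = (- (@cos R))%R by [].
  by rewrite -[sin x]opprK; exact: is_deriveN.
rewrite (@continuous_FTC2 _ _ (fun x => - cos x)%R).
- by rewrite cos0 cospi opprK -EFinB opprK.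
- exact: pi_gt0.
- by apply: continuous_subspaceT; exact: continuous_sin.
- have ccos : continuous (fun x : R => - cos x)%R.
    by move=> x; apply: cvgN; exact: continuous_cos.
  split.
  + by move=> x _; exact: ex_derive.
  + by apply: cvg_at_right_filter; exact: ccos.
  + by apply: cvg_at_left_filter; exact: ccos.
- by move=> x _; rewrite derive1E; exact: derive_val.
Qed.

Lemma surface_measureT : surface_measure setT = (4 * pi)%:E.
Proof.
have pi0 := pi_ge0 R.
rewrite /surface_measure preimage_setT setIT integral_mkcond.
have mf : measurable_fun setT ((fun t => (sin t.1)%:E) \_ spherical_dom).
  apply/(measurable_restrictT _ measurable_spherical_dom).
  by apply: measurable_funTS; exact: measurable_sin_fst.
rewrite fubini_tonelli1//=; last first.
  by move=> t; apply: erestrict_ge0 => {}t; exact: sin_spherical_dom_ge0.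
transitivity (\int[lebesgue_measure]_(x in `[0%R, pi])
    ((2 * pi)%:E * (sin x : R)%:E)).
  rewrite [RHS]integral_mkcond; apply: eq_integral => x _ /=.
  rewrite /fubini_F patchE; case: ifPn => xpi.
    transitivity (\int[lebesgue_measure]_(y in `[0%R, (2 * pi)%R])
        (sin x : R)%:E).
      rewrite [RHS]integral_mkcond; apply: eq_integral => y _.
      rewrite !patchE; congr (if _ then _ else _).
      by rewrite /spherical_dom in_setX/= xpi.
    rewrite integral_cst//= lebesgue_measure_itv/= lte_fin.
    rewrite pmulr_rgt0// pi_gt0 oppr0 adde0 muleC//.
  apply: integral0_eq => y _; rewrite patchE /spherical_dom in_setX/=.
  by rewrite (negbTE xpi).
rewrite ge0_integralZl//=.
- by rewrite integral_sin -EFinM mulrAC -natrM.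
- apply/measurable_EFinP; apply: measurable_funTS.
  by apply: continuous_measurable_fun; exact: continuous_sin.
- by move=> x; rewrite lee_fin => /sin_ge0_pi.
- by rewrite lee_fin mulr_ge0.
Qed.

Lemma sphere_spherical_coord t : sphere (spherical_coord t).
Proof.
rewrite /sphere /norm3 /spherical_coord/=.
rewrite !big_ord_recl big_ord0 addr0.
rewrite !(tnth_nth 0%R)/= !exprMn addrA -mulrDr cos2Dsin2 mulr1 addrC cos2Dsin2.
exact: sqrtr1.
Qed.

Let inv4pi_ge0 : (0 <= (4 * pi : R)^-1)%R.
Proof. by rewrite invr_ge0 mulr_ge0// pi_ge0. Qed.

Definition uniform_sphere : set (R3 R) -> \bar R :=
  mscale (NngNum inv4pi_ge0) surface_measure.

HB.instance Definition _ := Measure.on uniform_sphere.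

Let uniform_sphereT : uniform_sphere setT = 1.
Proof.
transitivity ((4 * pi : R)^-1%:E * surface_measure setT) => //.
rewrite surface_measureT -EFinM mulVf//.
by rewrite gt_eqF// mulr_gt0// pi_gt0.
Qed.

HB.instance Definition _ :=
  Measure_isProbability.Build _ _ _ uniform_sphere uniform_sphereT.

Lemma uniform_sphere_sphere : uniform_sphere sphere = 1.
Proof.
rewrite -uniform_sphereT; congr (_ * _).
rewrite /= /surface_measure (_ : _ @^-1` sphere = setT)// -subTset => t _.
exact: sphere_spherical_coord.
Qed.

End surface_measure.
Arguments surface_measure R : clear implicits.
Arguments uniform_sphere R : clear implicits.

Section power_probability.
Context d (T : measurableType d) (R : realType).

Definition cons_pair n (t : T * n.-tuple T) : n.+1.-tuple T :=
  [tuple of t.1 :: t.2].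

Lemma measurable_cons_pair n : measurable_fun setT (@cons_pair n).
Proof. exact: measurable_cons. Qed.

HB.instance Definition _ n :=
  isMeasurableFun.Build _ _ _ _ (@cons_pair n) (@measurable_cons_pair n).

Fixpoint power_probability (P : probability T R) (n : nat) :
    probability (n.-tuple T) R :=
  if n is n'.+1 then
    distribution (P \x power_probability P n')%E (@cons_pair n')
  else dirac [tuple].

End power_probability.

Section density.
Local Open Scope ereal_scope.

Definition mdensity d (T : measurableType d) (R : realType)
    (mu : {measure set T -> \bar R}) (f : T -> \bar R)
    (mf : measurable_fun setT f) (f0 : forall x, 0 <= f x) :=
  fun A : set T => \int[mu]_(x in A) f x.

Context d (T : measurableType d) (R : realType).
Variables (mu : {measure set T -> \bar R}) (f : T -> \bar R).
Hypotheses (mf : measurable_fun setT f) (f0 : forall x, 0 <= f x).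
Local Notation nu := (mdensity mu mf f0).

Let mdensity0 : nu set0 = 0.
Proof. exact: integral_set0. Qed.

Let mdensity_ge0 A : 0 <= nu A.
Proof. exact: integral_ge0. Qed.

Let mdensity_sigma_additive : semi_sigma_additive nu.
Proof. exact: semi_sigma_additive_nng_induced. Qed.

HB.instance Definition _ := isMeasure.Build _ _ _ nu
  mdensity0 mdensity_ge0 mdensity_sigma_additive.

End density.

Section coulomb_gas.
Context {R : realType}.
Local Open Scope ereal_scope.

(* Here 0^-1 = +oo and lne +oo = +oo, so a coincidence x_i = x_j with i <> j
   contributes +oo. *)
Definition log_energy (N : nat) (x : N.-tuple (R3 R)) : \bar R :=
  \sum_(i < N) \sum_(j < N | i != j)
    lne ((norm3 (sub3 (tnth x i) (tnth x j)))%:E)^-1.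

Definition boltzmann (N : nat) (beta : R) (x : N.-tuple (R3 R)) : \bar R :=
  expeR (- (beta%:E * log_energy x)).

Lemma measurable_log_energy N : measurable_fun setT (@log_energy N).
Proof.
apply: emeasurable_sum => i; rewrite /=.
rewrite (_ : (fun x => _) = (fun x : N.-tuple (R3 R) =>
    \sum_(j <- enum 'I_N | i != j)
      lne ((norm3 (sub3 (tnth x i) (tnth x j)))%:E)^-1)); last first.
  by apply/funext => x; rewrite big_enum_cond.
under eq_fun do rewrite -big_filter.
apply: emeasurable_sum => j.
set g := fun x : N.-tuple (R3 R) => norm3 (sub3 (tnth x i) (tnth x j)).
have mg : measurable_fun setT g.
  apply: (@measurableT_comp _ _ _ _ _ _ (@Num.sqrt R)).
    apply: nondecreasing_measurable => // ? ?; exact: ler_wsqrtr.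
  apply: measurable_sum => k; apply: measurable_funX.
  rewrite (_ : (fun x => _) = (fun x : N.-tuple (R3 R) =>
      tnth (tnth x i) k - tnth (tnth x j) k)%R); last first.
    by apply/funext => x; rewrite tnth_mktuple.
  have mt l : measurable_fun setT (fun x : N.-tuple (R3 R) =>
      tnth (tnth x l) k : measurableTypeR R).
    apply: (@measurableT_comp _ _ _ _ _ _ (fun y : R3 R => tnth y k)).
      exact: measurable_tnth.
    exact: measurable_tnth.
  by apply: measurable_funB; exact: mt.
rewrite (_ : (fun x => _) =
    (fun x => if (g x)%:E == 0 then +oo else (- ln (g x))%:E)); last first.
  apply/funext => x; rewrite -/(g x) inver eqe; case: ifPn => //= gx0.
  have g0 : (0 < g x)%R by rewrite lt_neqAle eq_sym gx0 sqrtr_ge0.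
  by rewrite leNgt invr_gt0 g0/= lnV.
apply: measurable_fun_ifT => //=.
  by apply: measurable_fun_eqe => //; exact/measurable_EFinP.
apply/measurable_EFinP; apply: measurableT_comp => //.
exact: measurableT_comp.
Qed.

Lemma measurable_boltzmann N beta : measurable_fun setT (@boltzmann N beta).
Proof.
have mH : measurable_fun setT
    (fun x : N.-tuple (R3 R) => - (beta%:E * log_energy x)).
  apply: measurableT_comp => //; apply: measurable_funeM.
  exact: measurable_log_energy.
rewrite (_ : @boltzmann N beta = (fun x =>
    if - (beta%:E * log_energy x) == +oo then +oo else
    if - (beta%:E * log_energy x) == -oo then 0 else
    (expR (fine (- (beta%:E * log_energy x))))%:E)); last first.
  by apply/funext => x; rewrite /boltzmann; case: (- _).
apply: measurable_fun_ifT => //=; first exact: measurable_fun_eqe.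
apply: measurable_fun_ifT => //=; first exact: measurable_fun_eqe.
apply/measurable_EFinP; apply: measurableT_comp => //.
exact: measurableT_comp.
Qed.

Lemma boltzmann_ge0 N beta x : 0 <= @boltzmann N beta x.
Proof. exact: expeR_ge0. Qed.

(* mnormalize divides by the partition function; its second argument is the
   fallback for a partition function equal to 0 or +oo, which does not occur
   when beta > 0. *)
Definition coulomb_gas (N : nat) (beta : R) :
    probability (N.-tuple (R3 R)) R :=
  mnormalize
    (mdensity
       (power_probability (uniform_sphere R) N)
       (@measurable_boltzmann N beta) (@boltzmann_ge0 N beta))
    (power_probability (uniform_sphere R) N).

End coulomb_gas.

(* Main.v *)
Require Import Defs.
From mathcomp Require Import all_boot all_order all_algebra.
From mathcomp Require Import all_classical all_reals all_analysis.
From mathcomp Require Import measurable_realfun.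
From mathcomp Require Import ring lra zify.
Set Implicit Arguments.
Unset Strict Implicit.
Unset Printing Implicit Defensive.
Import Order.TTheory GRing.Theory Num.Theory.
Import numFieldNormedType.Exports.
Local Open Scope classical_set_scope.
Local Open Scope ring_scope.

(* Write F(x) = prod_(i < j) |x_i - x_j|^2, so that H_N = - ln F and the Gibbs
   weight at beta = N is F^N, and let M be the maximum of F on the N-fold
   product of the sphere, attained at c.  Both claims follow from the single
   bound Z >= M^N N^(-9 N) on the partition function: the tail bound by
   Markov's inequality, and the bound on the mean by nonnegativity of the
   relative entropy of the Gibbs measure with respect to the uniform one.

   For the lower bound on Z, let one point run along a great circle.  Then F is
   a nonnegative trigonometric polynomial of degree N - 1 bounded by M, so by
   Bernstein's inequality it is Lipschitz with constant (N - 1) M / 2.  Moving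
   the points one at a time, F >= M / 3 as soon as every x_i is within angle
   2 u of c_i, where u = 2 / (3 N (N - 1)); a cap of angular radius 2 u has
   uniform measure at least (17 u / 18)^2 / 14. *)

(** * Elementary trigonometric bounds *)

Section elementary_trigonometry.
Context {R : realType}.
Implicit Types x y : R.

Lemma sinB_le x y : x <= y -> sin y - sin x <= y - x.
Proof.
move=> xy.
have [|z _ ->] := @MVT_segment R (@sin R) (@cos R) x y xy.
- by apply: continuous_subspaceT; exact: continuous_sin.
- by rewrite ler_piMl ?cos_le1// subr_ge0.
Qed.

Lemma sin_le_id x : 0 <= x -> sin x <= x.
Proof. by move/sinB_le; rewrite sin0 !subr0. Qed.

Lemma sqr_sin_le x : sin x ^+ 2 <= x ^+ 2.
Proof.
wlog x0 : x / 0 <= x.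
  move=> H; have [/H//|/ltW x0] := leP 0 x.
  by rewrite -[leLHS]sqrrN -sinN -[leRHS]sqrrN H// oppr_ge0.
have [x1|x1] := leP x 1.
  have s0 : 0 <= sin x.
    apply: sin_ge0_pi; rewrite x0 (le_trans x1)// (le_trans _ (pi_ge2 R))//.
    by rewrite ler1n.
  by rewrite ler_sqr// sin_le_id.
apply: (@le_trans _ _ 1); last by rewrite expr_ge1// ltW.
by rewrite -real_normK ?num_real// expr_le1 ?sin_max.
Qed.

Lemma one_sub_cos x : 1 - cos x = 2 * sin (x / 2) ^+ 2.
Proof.
have -> : cos x = cos ((x / 2) *+ 2) by congr cos; rewrite -mulr_natr; lra.
by rewrite cos_mulr2n cos2sin2; lra.
Qed.

Lemma cos_ge x : 1 - x ^+ 2 / 2 <= cos x.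
Proof.
have := sqr_sin_le (x / 2); have := one_sub_cos x.
by rewrite expr_div_n; lra.
Qed.

(** [2 sin^2 (x / 2)] is at most 2 and at most [x^2 / 2], and the smaller of these never exceeds
    [|x|]. This linear bound complements the quadratic one in the estimate of caps. *)
Lemma one_sub_cos_le_norm x : 1 - cos x <= `|x|.
Proof.
have := sqr_sin_le (x / 2); have := one_sub_cos x.
have : sin (x / 2) ^+ 2 <= 1.
  by rewrite -real_normK ?num_real// expr_le1 ?sin_max.
rewrite expr_div_n -[x ^+ 2]real_normK ?num_real//.
have := normr_ge0 x; set a := `|x|; nra.
Qed.

(** By the mean value theorem [sin x] is [x] times a cosine, which [cos_ge] bounds below. The
    separate [y] gives one slope for all of [[0, y]]. *)
Lemma sin_ge_cosM x y : 0 <= x -> x <= y -> y <= 1 -> (1 - y ^+ 2 / 2) * x <= sin x.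
Proof.
move=> x0 xy y1.
have [|z zI sE] := @MVT_segment R (@sin R) (@cos R) 0 x x0.
- by apply: continuous_subspaceT; exact: continuous_sin.
move: sE; rewrite sin0 !subr0 => ->.
rewrite ler_wpM2r//; apply: le_trans (cos_ge z).
have /itvP zz := zI.
have : z ^+ 2 <= y ^+ 2.
  by rewrite ler_sqr ?nnegrE ?zz// (le_trans _ xy) ?zz// (le_trans x0).
lra.
Qed.

(** It suffices that [cos (8 / 5)] is not positive. Three angle doublings starting from a lower
    bound on [sin (1 / 5)] contradict its positivity. *)
Lemma pi_le : pi <= 16 / 5 :> R.
Proof.
have -> : pi = 2 * (pi / 2) :> R by lra.
suff : pi / 2 <= 8 / 5 :> R by lra.
rewrite leNgt; apply/negP => lt8.
have c8 : 0 < cos (8 / 5 : R).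
  by apply: cos_gt0_pihalf; rewrite lt8 andbT; have := pi_ge0 R; lra.
have s1 : (1 - (1 / 5) ^+ 2 / 2) * (1 / 5) <= sin (1 / 5 : R).
  by apply: sin_ge_cosM; lra.
have s2 := one_sub_cos (2 / 5 : R).
have e1 : cos (8 / 5) = 2 * cos (4 / 5) ^+ 2 - 1 :> R.
  have -> : 8 / 5 = (4 / 5) *+ 2 :> R by rewrite -mulr_natr; lra.
  by rewrite cos_mulr2n -mulr_natl.
have e2 : cos (4 / 5) = 2 * cos (2 / 5) ^+ 2 - 1 :> R.
  have -> : 4 / 5 = (2 / 5) *+ 2 :> R by rewrite -mulr_natr; lra.
  by rewrite cos_mulr2n -mulr_natl.
have e3 : (2 / 5) / 2 = 1 / 5 :> R by lra.
rewrite e3 in s2.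
have c4 : 0 <= cos (2 / 5 : R).
  by apply: le_trans (cos_ge _); rewrite expr2; lra.
have c4' : 0 <= cos (4 / 5 : R).
  by apply: le_trans (cos_ge _); rewrite expr2; lra.
have : cos (2 / 5 : R) <= 9235 / 10000 by nra.
move=> h; have : cos (4 / 5 : R) <= 7058 / 10000 by nra.
move=> h'; nra.
Qed.

End elementary_trigonometry.

(** * Bernstein's inequality *)

Section trigonometric_polynomials.
Context {R : realType}.
Implicit Types (f g : R -> R) (n k : nat).

(** Real trigonometric polynomials of degree at most [n], generated by cosines with a phase. The
    phase covers sines, so products need a single product-to-sum identity. *)
Inductive trig_poly n : (R -> R) -> Prop :=
| trig_wave a k psi : (k <= n)%N ->
    trig_poly n (fun t => a * cos (k%:R * t + psi))
| trig_add f g : trig_poly n f -> trig_poly n g ->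
    trig_poly n (fun t => f t + g t).

Lemma trig_poly_cst n c : trig_poly n (fun=> c).
Proof.
rewrite (_ : (fun=> c) = fun t => c * cos (0%:R * t + 0)).
  exact: trig_wave.
by apply/funext => t; rewrite mul0r add0r cos0 mulr1.
Qed.

Lemma trig_poly_cos c : trig_poly 1 (fun t => c * cos t).
Proof.
rewrite (_ : (fun t => _) = fun t => c * cos (1%:R * t + 0)).
  exact: trig_wave.
by apply/funext => t; rewrite mul1r addr0.
Qed.

Lemma trig_poly_sin c : trig_poly 1 (fun t => c * sin t).
Proof.
rewrite (_ : (fun t => _) = fun t => c * cos (1%:R * t + - (pi / 2))).
  exact: trig_wave.
by apply/funext => t; rewrite mul1r cosBpihalf.
Qed.

Lemma trig_polyM m n f g :
  trig_poly m f -> trig_poly n g -> trig_poly (m + n) (fun t => f t * g t).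
Proof.
elim=> [a k psi km|f1 f2 _ IH1 _ IH2] tg; last first.
  rewrite (_ : (fun t => _) = fun t => f1 t * g t + f2 t * g t).
    by apply: trig_add; [exact: IH1|exact: IH2].
  by apply/funext => t; rewrite mulrDl.
elim: tg => [b l chi ln|g1 g2 _ IH1 _ IH2]; last first.
  rewrite (_ : (fun t => _) = fun t => a * cos (k%:R * t + psi) * g1 t +
                                       a * cos (k%:R * t + psi) * g2 t).
    by apply: trig_add; [exact: IH1|exact: IH2].
  by apply/funext => t; rewrite mulrDr.
(* Frequencies are natural numbers, so the difference [i - j] asks for [j <= i]; the other order
   follows by commutativity. *)
have prodE (i j : nat) (c e x y : R) : (j <= i)%N ->
    (fun t => c * cos (i%:R * t + x) * (e * cos (j%:R * t + y))) =
    (fun t => c * e / 2 * cos ((i + j)%:R * t + (x + y)) +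
              c * e / 2 * cos ((i - j)%:R * t + (x - y))).
  move=> ji; apply/funext => t.
  have -> : (i + j)%:R * t + (x + y) = (i%:R * t + x) + (j%:R * t + y).
    by rewrite natrD; ring.
  have -> : (i - j)%:R * t + (x - y) = (i%:R * t + x) - (j%:R * t + y).
    by rewrite natrB//; ring.
  by move: (_ + x) (_ + y) => u v; rewrite cosD cosB; field.
have [lk|/ltnW kl] := leqP l k.
  by rewrite prodE//; apply: trig_add; apply: trig_wave; lia.
under eq_fun do rewrite mulrC.
by rewrite prodE//; apply: trig_add; apply: trig_wave; lia.
Qed.

(** Degrees add under products. They may depend on the factor, so that constant factors count for
    0. *)
Lemma trig_poly_prod (I : Type) (r : seq I) (P : pred I) (d : I -> nat)
    (f : I -> R -> R) :
  (forall i, P i -> trig_poly (d i) (f i)) ->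
  trig_poly (\sum_(i <- r | P i) d i) (fun t => \prod_(i <- r | P i) f i t).
Proof.
move=> tf; elim: r => [|i r IH].
  by rewrite big_nil; under eq_fun do rewrite big_nil; exact: trig_poly_cst.
rewrite big_cons (_ : (fun t => _) = fun t =>
    if P i then f i t * \prod_(j <- r | P j) f j t
    else \prod_(j <- r | P j) f j t).
  by case: ifPn => // Pi; exact/trig_polyM/IH/tf.
by apply/funext => t; rewrite big_cons.
Qed.

Lemma sin_natMpi k : sin (k%:R * pi) = 0 :> R.
Proof.
elim: k => [|k IH]; first by rewrite mul0r sin0.
by rewrite -addn1 natrD mulrDl mul1r sinDpi IH oppr0.
Qed.

Section riesz.
Variable n : nat.
Hypothesis n0 : (0 < n)%N.

(* Riesz interpolation: [2 moment 1 f'(t)] is the sum over [j] of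
   [(-1)^j weight j (f (t + node j) - f (t - node j))].  As [moment k] is linear
   in [k], the weights add up to [moment n = n moment 1], which is all that
   Bernstein's inequality needs: [moment 1] is never evaluated. *)
Let node (j : nat) : R := (2 * j + 1)%:R * (pi / (2 * n)%:R).
Let weight (j : nat) : R := (2 * sin (node j / 2) ^+ 2)^-1.
Let moment (k : nat) : R :=
  \sum_(j < 2 * n) (-1) ^+ j * weight j * sin (k%:R * node j).

Let sin_node_neq0 j : (j < 2 * n)%N -> sin (node j / 2) != 0.
Proof.
move=> jn; rewrite gt_eqF// sin_gt0_pi//.
have p0 := pi_gt0 R.
have ->: node j / 2 = ((2 * j + 1)%:R / (4 * n)%:R) * pi.
  rewrite /node !natrM; field.
  by rewrite pnatr_eq0 -lt0n n0.
apply/andP; split.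
  by rewrite mulr_gt0// divr_gt0// ltr0n; lia.
by rewrite gtr_pMl// ltr_pdivrMr ?ltr0n ?mul1r ?ltr_nat; lia.
Qed.

Let weight_gt0 j : (j < 2 * n)%N -> 0 < weight j.
Proof. by move=> jn; rewrite invr_gt0 mulr_gt0// exprn_even_gt0//= sin_node_neq0. Qed.

(* Multiplying by [2 cos (k h)], [h = pi / 2n], makes the alternating sum
   telescope. *)
Let alternating_sin_sum k : (k < n)%N ->
  \sum_(j < 2 * n) (-1) ^+ j * sin (k%:R * node j) = 0.
Proof.
move=> kn; pose h : R := pi / (2 * n)%:R.
have c0 : 2 * cos (k%:R * h) != 0.
  rewrite mulf_neq0// gt_eqF// cos_gt0_pihalf//.
  have p0 := pi_gt0 R.
  have -> : k%:R * h = (k%:R / n%:R) * (pi / 2).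
    by rewrite /h natrM; field; rewrite pnatr_eq0 -lt0n n0.
  have kn0 : 0 <= k%:R / n%:R :> R by rewrite divr_ge0.
  have kn1 : k%:R / n%:R < 1 :> R.
    by rewrite ltr_pdivrMr ?ltr0n// mul1r ltr_nat.
  apply/andP; split; nra.
apply: (mulfI c0); rewrite mulr0 mulr_sumr.
pose u j : R := (-1) ^+ j.+1 * sin (k%:R * ((2 * j)%:R * h)).
rewrite (eq_bigr (fun j : 'I__ => u j.+1 - u j)); last first.
  move=> j _; rewrite /u /node -/h !exprS.
  have -> : k%:R * ((2 * j.+1)%:R * h) = k%:R * ((2 * j + 1)%:R * h) + k%:R * h.
    ring.
  have -> : k%:R * ((2 * j)%:R * h) = k%:R * ((2 * j + 1)%:R * h) - k%:R * h.
    ring.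
  by rewrite sinD sinB; ring.
rewrite -(big_mkord xpredT (fun j => u j.+1 - u j)) telescope_sumr//.
rewrite /u muln0 mul0r mulr0 sin0 mulr0 subr0.
have -> : k%:R * ((2 * (2 * n))%:R * h) = (k + k)%:R * pi.
  by rewrite /h natrD !natrM; field; rewrite pnatr_eq0 -lt0n n0.
by rewrite sin_natMpi mulr0.
Qed.

(** The second difference of [sin (k x)] in [k] is [-2 (1 - cos x) sin ((k + 1) x)]. The factor
    [1 - cos x] is the inverse of the weight, so only the vanishing alternating sum is left. *)
Let moment_rec k : (k.+1 < n)%N -> moment k.+2 = 2 * moment k.+1 - moment k.
Proof.
move=> kn; apply/eqP; rewrite -subr_eq0 /moment mulr_sumr -!sumrB.
rewrite (eq_bigr (fun j : 'I__ =>
  -2 * ((-1) ^+ j * sin (k.+1%:R * node j)))); last first.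
  move=> j _; set x := node j.
  have -> : k.+2%:R * x = k.+1%:R * x + x by ring.
  have -> : k%:R * x = k.+1%:R * x - x by ring.
  rewrite sinD sinB.
  have cE : cos x = 1 - 2 * sin (x / 2) ^+ 2.
    have -> : cos x = cos ((x / 2) *+ 2) by congr cos; rewrite -mulr_natr; lra.
    by rewrite cos_mulr2n cos2sin2; lra.
  rewrite cE /weight -/x; field.
  exact: sin_node_neq0.
by rewrite -mulr_sumr alternating_sin_sum// mulr0.
Qed.

Let momentE k : (k <= n)%N -> moment k = k%:R * moment 1.
Proof.
(* The recurrence has order two, so the induction carries two consecutive values. *)
suff : (k <= n)%N -> moment k = k%:R * moment 1 /\
    ((k < n)%N -> moment k.+1 = k.+1%:R * moment 1).
  by move=> H kn; have [] := H kn.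
elim: k => [_|k IH kn].
  split; last by rewrite mul1r.
  by rewrite /moment big1 ?mul0r// => j _; rewrite mul0r sin0 mulr0.
have [IH1 /(_ kn) IH2] := IH (ltnW kn); split => // kn'.
rewrite moment_rec// IH1 IH2; ring.
Qed.

(** At the nodes [sin (n x)] equals [(-1)^j], which cancels the sign in front of each weight. *)
Let moment_n : moment n = \sum_(j < 2 * n) weight j.
Proof.
apply: eq_bigr => j _.
suff -> : sin (n%:R * node j) = (-1) ^+ j.
  by rewrite mulrAC -expr2 sqrr_sign mul1r.
have -> : n%:R * node j = j%:R * pi + pi / 2.
  by rewrite /node natrD !natrM; field; rewrite pnatr_eq0 -lt0n n0.
rewrite sinDpihalf; elim: (nat_of_ord j) => [|i IH].
  by rewrite mul0r cos0.
by rewrite -natr1 mulrDl mul1r cosDpi IH exprS mulN1r.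
Qed.

Let moment1_gt0 : 0 < moment 1.
Proof.
have : 0 < n%:R * moment 1.
  rewrite -(momentE (leqnn n)) moment_n.
  have h0 : (0 < 2 * n)%N by lia.
  rewrite (bigD1 (Ordinal h0))//= ltr_wpDr ?weight_gt0//.
  by apply: sumr_ge0 => j _; apply/ltW/weight_gt0.
by rewrite pmulr_rgt0// ltr0n.
Qed.

(** Both sides are linear in [f], so a single wave is enough. There each symmetric difference is
    [-2 a sin (k t + psi) sin (k x)], and the sum becomes a multiple of [moment k], that is of [k]
    times [moment 1]. *)
Let riesz_formula f : trig_poly n f -> exists f' : R -> R, forall t : R,
  is_derive t 1 f (f' t) /\
  2 * moment 1 * f' t = \sum_(j < 2 * n) (-1) ^+ j * weight j *
    (f (t + node j) - f (t - node j)).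
Proof.
elim=> [a k psi kn|{}f g _ [f' IHf] _ [g' IHg]].
  exists (fun t => - (a * k%:R) * sin (k%:R * t + psi)) => t; split.
    pose l (t : R) := k%:R * t + psi.
    have dl : is_derive t 1 l (k%:R : R).
      have -> : l = (fun x : R => (k%:R : R) * x) \+ cst psi by [].
      apply: is_derive_eq; rewrite addr0; exact: mulr1.
    have := @is_derive1_comp R (@cos R) l t _ _ (is_derive_cos (l t)) dl.
    move/(is_deriveZ a) => H.
    have -> : - (a * k%:R) * sin (k%:R * t + psi) = a *: (k%:R * - sin (l t)).
      by rewrite /GRing.scale/= /l; ring.
    apply: is_derive_eq H _; rewrite /GRing.scale /=; ring.
  rewrite (eq_bigr (fun j : 'I__ => -2 * a * sin (k%:R * t + psi) *
     ((-1) ^+ j * weight j * sin (k%:R * node j)))); last first.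
    move=> j _ /=; set x := node j.
    have -> : k%:R * (t + x) + psi = (k%:R * t + psi) + k%:R * x by ring.
    have -> : k%:R * (t - x) + psi = (k%:R * t + psi) - k%:R * x by ring.
    move: (_ + psi) (_ * x) (weight j) => u v w.
    by rewrite cosD cosB; ring.
  by rewrite -mulr_sumr -/(moment k) (momentE kn); move: (moment 1) => D; ring.
exists (fun t => f' t + g' t) => t; have [df Ef] := IHf t.
have [dg Eg] := IHg t; split; first exact: is_deriveD.
rewrite mulrDr Ef Eg -big_split/=; apply: eq_bigr => j _; ring.
Qed.

(** As [f] takes values in [[0, M]], each difference in the interpolation formula is at most [M] in
    absolute value, not [2 M]; this gives the factor one half. The weights sum to [n * moment 1],
    and [moment 1] cancels. *)
Lemma bernstein f (M : R) : trig_poly n f -> (forall t, 0 <= f t <= M) ->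
  exists f' : R -> R, forall t : R, is_derive t 1 f (f' t) /\ `|f' t| <= n%:R * M / 2.
Proof.
move=> /riesz_formula[f' Hf] fM; exists f' => t; have [df E] := Hf t.
split=> //; have m0 := moment1_gt0.
have : 2 * moment 1 * `|f' t| <= \sum_(j < 2 * n) weight j * M.
  rewrite -[2 * _]ger0_norm; last by rewrite mulr_ge0// ltW.
  rewrite -normrM E; apply: (le_trans (ler_norm_sum _ _ _)).
  apply: ler_sum => j _; rewrite !normrM normrX normrN1 expr1n mul1r.
  rewrite gtr0_norm ?weight_gt0// ler_wpM2l//; first exact/ltW/weight_gt0.
  have := fM (t + node j); have := fM (t - node j).
  by rewrite ler_norml => /andP[? ?] /andP[? ?]; apply/andP; split; lra.
rewrite -mulr_suml -moment_n (momentE (leqnn n)) => H.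
rewrite -(ler_pM2l (_ : 0 < 2 * moment 1)); last by rewrite mulr_gt0.
by apply: (le_trans H); rewrite le_eqVlt; apply/orP; left; apply/eqP; field.
Qed.

End riesz.

Lemma trig_poly_lipschitz n f (M s t : R) : (0 < n)%N -> trig_poly n f ->
  (forall x, 0 <= f x <= M) -> s <= t ->
  `|f t - f s| <= n%:R * M / 2 * (t - s).
Proof.
move=> n0 tf fM st; have [f' Hf] := bernstein n0 tf fM.
have [x _||z _ ->] := @MVT_segment R f f' s t st.
- by have [] := Hf x.
- apply: derivable_within_continuous => x _.
  by have [df _] := Hf x; exact: ex_derive.
- rewrite normrM [X in _ * X]ger0_norm ?subr_ge0//.
  by rewrite ler_wpM2r ?subr_ge0//; have [] := Hf z.
Qed.

End trigonometric_polynomials.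

(** * Great circles and the product of squared distances *)

Section sphere_geometry.
Context {R : realType}.
Implicit Types x y v : R3 R.

Definition dot3 x y : R := \sum_(k < 3) tnth x k * tnth y k.

Definition sqdist x y : R := \sum_(k < 3) (tnth x k - tnth y k) ^+ 2.

(** For orthonormal [x] and [v], the unit-speed great circle that leaves [x] in the direction
    [v]. *)
Definition arc x v (t : R) : R3 R :=
  [tuple cos t * tnth x k + sin t * tnth v k | k < 3].

Lemma norm3_sub3 x y : norm3 (sub3 x y) = Num.sqrt (sqdist x y).
Proof. by congr Num.sqrt; apply: eq_bigr => k _; rewrite tnth_mktuple. Qed.

Lemma sqdist_ge0 x y : 0 <= sqdist x y.
Proof. by apply: sumr_ge0 => k _; exact: sqr_ge0. Qed.

Lemma sqdistC x y : sqdist x y = sqdist y x.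
Proof. by apply: eq_bigr => k _; rewrite -sqrrN opprB. Qed.

Lemma sqdist_eq0 x y : sqdist x y = 0 -> x = y.
Proof.
move=> /eqP; rewrite psumr_eq0 => [/allP xy|k _]; last exact: sqr_ge0.
apply: eq_from_tnth => k; apply/eqP; rewrite -subr_eq0 -sqrf_eq0.
by apply: xy; rewrite mem_index_enum.
Qed.

Lemma sphereP x : sphere x <-> dot3 x x = 1.
Proof.
have -> : sphere x = (Num.sqrt (dot3 x x) = 1).
  by rewrite /sphere /= /norm3; under eq_bigr do rewrite expr2.
have d0 : 0 <= dot3 x x by apply: sumr_ge0 => k _; rewrite -expr2 sqr_ge0.
split=> [s1|->]; last exact: sqrtr1.
by rewrite -(sqr_sqrtr d0) s1 expr1n.
Qed.

Lemma dot3C x y : dot3 x y = dot3 y x.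
Proof. by apply: eq_bigr => k _; rewrite mulrC. Qed.

Lemma dot3_arcl x v t y : dot3 (arc x v t) y = cos t * dot3 x y + sin t * dot3 v y.
Proof.
rewrite /dot3 !mulr_sumr -big_split/=; apply: eq_bigr => k _.
by rewrite tnth_mktuple mulrDl !mulrA.
Qed.

Lemma sqdistE x y : sqdist x y = dot3 x x + dot3 y y - 2 * dot3 x y.
Proof.
have key (a b : R) : (a - b) ^+ 2 = a * a + b * b - 2 * (a * b) by ring.
by rewrite mulr_sumr -big_split -sumrB; apply: eq_bigr => k _; exact: key.
Qed.

Lemma sphere_sqdist x y : sphere x -> sphere y -> sqdist x y = 2 - 2 * dot3 x y.
Proof. by move=> /sphereP xx /sphereP yy; rewrite sqdistE xx yy. Qed.

Lemma sphere_arc x v t : sphere x -> sphere v -> dot3 x v = 0 ->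
  sphere (arc x v t).
Proof.
move=> /sphereP xx /sphereP vv xv; apply/sphereP.
rewrite dot3_arcl ![dot3 _ (arc _ _ _)]dot3C !dot3_arcl xx vv xv dot3C xv.
by rewrite !mulr0 !mulr1 addr0 add0r -!expr2 cos2Dsin2.
Qed.

Lemma arc0 x v : arc x v 0 = x.
Proof.
by apply: eq_from_tnth => k; rewrite tnth_mktuple cos0 sin0 mul1r mul0r addr0.
Qed.

Lemma sphere_dot3_itv x y : sphere x -> sphere y -> -1 <= dot3 x y <= 1.
Proof.
move=> sx sy; apply/andP; split; last first.
  by have := sqdist_ge0 x y; rewrite sphere_sqdist//; lra.
have : 0 <= \sum_(k < 3) (tnth x k + tnth y k) ^+ 2.
  by apply: sumr_ge0 => k _; exact: sqr_ge0.
have -> : \sum_(k < 3) (tnth x k + tnth y k) ^+ 2 =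
    dot3 x x + dot3 y y + 2 * dot3 x y.
  have key (a b : R) : (a + b) ^+ 2 = a * a + b * b + 2 * (a * b) by ring.
  by rewrite mulr_sumr -!big_split; apply: eq_bigr => k _; exact: key.
by move/sphereP : sx => ->; move/sphereP : sy => ->; lra.
Qed.

(** The parameter [t] is the angle between the points and [v] is the normalized component of [y]
    orthogonal to [x]. If [t = 0] the points agree; otherwise [t <= a < pi] rules out the antipode,
    so [sin t] is positive. *)
Lemma arc_between x y (a : R) : sphere x -> sphere y -> 0 <= a < pi ->
  cos a <= dot3 x y -> y = x \/
  exists v t, [/\ sphere v, dot3 x v = 0, 0 <= t <= a & arc x v t = y].
Proof.
move=> sx sy /andP[a0 api] ca; have d1 := sphere_dot3_itv sx sy.
pose t := acos (dot3 x y).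
have ct : cos t = dot3 x y by rewrite acosK// in_itv.
have t0 : 0 <= t by rewrite acos_ge0.
have ta : t <= a.
  rewrite leNgt; apply/negP; rewrite -ltr_cos ?ct ?in_itv/= ?t0 ?a0//=.
  - by apply/negP; rewrite -leNgt.
  - exact: ltW.
  - exact: acos_lepi.
have [t0'|tn0] := eqVneq t 0.
  left; apply/esym/sqdist_eq0.
  by rewrite sphere_sqdist// -ct t0' cos0; lra.
right; have st : 0 < sin t.
  by rewrite sin_gt0_pi// lt_neqAle eq_sym tn0 t0 (le_lt_trans ta).
have xx : dot3 x x = 1 by exact/sphereP.
have yy : dot3 y y = 1 by exact/sphereP.
have sn0 : sin t != 0 by rewrite gt_eqF.
pose v : R3 R := [tuple (tnth y k - cos t * tnth x k) / sin t | k < 3].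
have vE z : dot3 v z = (dot3 y z - cos t * dot3 x z) / sin t.
  rewrite /dot3 mulr_sumr -sumrB mulr_suml; apply: eq_bigr => k _.
  by rewrite tnth_mktuple mulrAC mulrBl mulrA.
have xv : dot3 x v = 0 by rewrite dot3C vE xx dot3C ct mulr1 subrr mul0r.
exists v, t; split=> //; last 2 first.
- by rewrite t0.
- by apply: eq_from_tnth => k; rewrite !tnth_mktuple [sin t * _]mulrC divfK// addrC subrK.
apply/sphereP; rewrite vE xv dot3C vE yy -ct.
have := cos2Dsin2 t; set s := sin t in sn0 *; set c := cos t => e.
by rewrite -(_ : s ^+ 2 = 1 - c * c) ?mulr0 ?subr0; [field|rewrite -e; ring].
Qed.

End sphere_geometry.

(** * Stability of the product of squared distances under moving points *)

Section pair_product.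
Context {R : realType} {N : nat}.
Implicit Types (c d : 'I_N -> R3 R) (i : 'I_N).

Definition pair_prod c : R :=
  \prod_(i < N) \prod_(j < N | (i < j)%N) sqdist (c i) (c j).

Definition move_point c i y : 'I_N -> R3 R :=
  fun j => if j == i then y else c j.

Lemma pair_prod_ge0 c : 0 <= pair_prod c.
Proof. by apply: prodr_ge0 => i _; apply: prodr_ge0 => j _; exact: sqdist_ge0. Qed.

Lemma sphere_move_point c i y : (forall j, sphere (c j)) -> sphere y ->
  forall j, sphere (move_point c i y j).
Proof. by move=> sc sy j; rewrite /move_point; case: eqP. Qed.

(** The index [i] forms one pair with each other index. The left side has the shape of the degree
    that two nested uses of [trig_poly_prod] produce. *)
Lemma pairs_with i :
  (\sum_(a < N) \sum_(b < N | a < b) ((a == i) + (b == i)) = N.-1)%N.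
Proof.
under eq_bigr do rewrite big_split/=.
rewrite big_split/= [X in (_ + X)%N](exchange_big_dep xpredT)//=.
rewrite [X in (X + _)%N](bigD1 i)//= [X in (_ + X + _)%N]big1; last first.
  by move=> j /negbTE ji; rewrite big1// => k _; rewrite ji.
rewrite [X in (_ + X)%N](bigD1 i)//= [X in (_ + (_ + X))%N]big1; last first.
  by move=> j /negbTE ji; rewrite big1// => k _; rewrite ji.
rewrite eqxx !addn0 big_mkcond/= [X in (_ + X)%N]big_mkcond/= -big_split/=.
rewrite -[in RHS](card_ord N) -(cardC1 i) -sum1_card [RHS]big_mkcond/=.
apply: eq_bigr => j _; rewrite unfold_in/= -val_eqE/=.
by case: ltngtP.
Qed.

(** On the sphere a squared distance is 2 minus twice an inner product, hence affine in [cos t] and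
    [sin t] along a great circle. So each of the [N - 1] factors involving the moving point has
    degree 1. *)
Lemma trig_poly_pair_prod c i x v : (forall j, sphere (c j)) ->
  sphere x -> sphere v -> dot3 x v = 0 ->
  trig_poly N.-1 (fun t => pair_prod (move_point c i (arc x v t))).
Proof.
move=> sc sx sv xv; rewrite -(pairs_with i).
apply: trig_poly_prod => a _; apply: trig_poly_prod => b ab.
have tp y : sphere y -> trig_poly 1 (fun t => sqdist (arc x v t) y).
  move=> sy; rewrite (_ : (fun t => _) = fun t =>
      (2 + (-2 * dot3 x y) * cos t) + (-2 * dot3 v y) * sin t).
    apply: trig_add; last exact: trig_poly_sin.
    by apply: trig_add; [exact: trig_poly_cst|exact: trig_poly_cos].
  apply/funext => t; rewrite sphere_sqdist ?dot3_arcl//; first by ring.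
  exact: sphere_arc.
rewrite /move_point; have [ai|ai] := eqVneq a i; have [bi|bi] := eqVneq b i.
- by move: ab; rewrite ai bi ltnn.
- exact: tp.
- by under eq_fun do rewrite sqdistC; exact: tp.
- exact: trig_poly_cst.
Qed.

Variable M : R.
Hypothesis pair_prod_le : forall c, (forall j, sphere (c j)) -> pair_prod c <= M.

Lemma pair_prod_move_point c i y (a : R) : (1 < N)%N ->
  (forall j, sphere (c j)) -> sphere y -> 0 <= a < pi ->
  cos a <= dot3 (c i) y ->
  `|pair_prod (move_point c i y) - pair_prod c| <= N.-1%:R * M / 2 * a.
Proof.
move=> N1 sc sy aI ca; have sci := sc i.
have M0 : 0 <= M by exact: le_trans (pair_prod_ge0 c) (pair_prod_le sc).
have ciE : move_point c i (c i) = c.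
  by apply/funext => j; rewrite /move_point; case: eqP => // ->.
have K0 : 0 <= N.-1%:R * M / 2 by rewrite divr_ge0// mulr_ge0.
have [->|[v [t [sv xv /andP[t0 ta] ty]]]] := arc_between sci sy aI ca.
  by rewrite ciE subrr normr0 mulr_ge0//; case/andP: aI.
have := trig_poly_pair_prod i sc sci sv xv.
move/(@trig_poly_lipschitz _ _ _ M 0 t).
rewrite ty arc0 ciE subr0 => H; apply: (le_trans (H _ _ _)) => //.
- by case: (N) N1 => [//|[]].
- move=> s; rewrite pair_prod_ge0/=; apply: pair_prod_le.
  exact/sphere_move_point/sphere_arc.
- by rewrite ler_wpM2l.
Qed.

Lemma pair_prod_perturb c d (a : R) : (1 < N)%N ->
  (forall j, sphere (c j)) -> (forall j, sphere (d j)) -> 0 <= a < pi ->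
  (forall j, cos a <= dot3 (c j) (d j)) ->
  pair_prod c - (N * N.-1)%:R * M / 2 * a <= pair_prod d.
Proof.
move=> N1 sc sd aI ca.
(* [h k] has the first [k] points already moved. All these configurations lie on the sphere, so the
   bound [M] serves at every stage and the losses simply add up. *)
pose h k := fun j : 'I_N => if (j < k)%N then d j else c j.
have sh k j : sphere (h k j) by rewrite /h; case: ifP.
have hN : h N = d by apply/funext => j; rewrite /h ltn_ord.
have h0 : h 0 = c by apply/funext => j; rewrite /h.
suff : forall k, (k <= N)%N ->
    pair_prod c - k%:R * (N.-1%:R * M / 2 * a) <= pair_prod (h k).
  by move=> /(_ N (leqnn _)); rewrite hN natrM -!mulrA.
elim=> [|k IH kN]; first by rewrite h0 mul0r subr0.
have hk : h k.+1 = move_point (h k) (Ordinal kN) (d (Ordinal kN)).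
  apply/funext => j; rewrite /h /move_point ltnS leq_eqVlt -val_eqE/=.
  by case: eqP => //= jk; congr d; apply: val_inj.
have := @pair_prod_move_point (h k) (Ordinal kN) _ a N1 (sh k) (sd _) aI.
rewrite {1}/h/= ltnn => /(_ _ (ca _)); rewrite -hk ler_norml => /andP[+ _].
by have := IH (ltnW kN); rewrite -natr1; lra.
Qed.

End pair_product.

(** * Spherical coordinates and existence of minimizers *)

Section spherical_coordinates.
Context {R : realType}.

Lemma dot3_spherical_coord (t u : R * R) :
  dot3 (spherical_coord t) (spherical_coord u) =
  sin t.1 * sin u.1 * cos (t.2 - u.2) + cos t.1 * cos u.1.
Proof.
rewrite /dot3 /spherical_coord/= !big_ord_recl big_ord0 addr0.
by rewrite !(tnth_nth 0)/= cosB; ring.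
Qed.

Lemma spherical_coord_surj (x : R3 R) : sphere x ->
  exists2 t, spherical_dom t & spherical_coord t = x.
Proof.
move=> /sphereP; rewrite /dot3 !big_ord_recl big_ord0 addr0.
set k0 : 'I_3 := ord0; set k1 : 'I_3 := lift _ _; set k2 : 'I_3 := lift _ _.
have coordE p q : spherical_coord (p, q) = x <->
    [/\ sin p * cos q = tnth x k0, sin p * sin q = tnth x k1 &
        cos p = tnth x k2].
  split=> [<-|[e0 e1 e2]]; first by split; rewrite /spherical_coord (tnth_nth 0).
  apply: eq_from_tnth => -[[|[|[|//]]] i3]; rewrite (tnth_nth 0)/=.
  - by rewrite e0; congr (tnth x); apply: val_inj.
  - by rewrite e1; congr (tnth x); apply: val_inj.
  - by rewrite e2; congr (tnth x); apply: val_inj.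
move: coordE; set a : R := tnth x k0; set b : R := tnth x k1.
set c : R := tnth x k2 => coordE nx.
have c1 : -1 <= c <= 1 by apply/andP; split; nra.
pose p := acos c.
have cp : cos p = c by rewrite acosK// in_itv.
have p0 : 0 <= p <= pi by rewrite acos_ge0// acos_lepi.
have pi0 := pi_ge0 R.
(* At a pole the first two coordinates vanish and the longitude is arbitrary; 0 is taken. *)
have [s0|s0] := eqVneq (sin p) 0.
  exists (p, 0).
    by split => /=; rewrite in_itv/= ?p0// lexx mulr_ge0.
  have := cos2Dsin2 p; rewrite s0 expr0n/= addr0 cp => c2.
  by apply/coordE; rewrite s0 !mul0r; split=> //; nra.
have sp0 : 0 < sin p by rewrite lt_neqAle eq_sym s0 sin_ge0_pi.
have ab : a ^+ 2 + b ^+ 2 = sin p ^+ 2.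
  by have := cos2Dsin2 p; rewrite cp => h; lra.
have a1 : -1 <= a / sin p <= 1.
  rewrite ler_pdivlMr// ler_pdivrMr// mulN1r mul1r.
  by apply/andP; split; nra.
pose q := acos (a / sin p).
have cq : cos q = a / sin p by rewrite acosK// in_itv.
have q0 : 0 <= q <= pi by rewrite acos_ge0// acos_lepi.
have sq0 : 0 <= sin q by rewrite sin_ge0_pi.
have sq : (sin p * sin q) ^+ 2 = b ^+ 2.
  rewrite exprMn [sin q ^+ 2]sin2cos2 cq expr_div_n mulrBr mulr1 mulrC divfK ?sqrf_eq0//.
  lra.
have spq : 0 <= sin p * sin q by rewrite mulr_ge0// ltW.
(* [acos] only yields longitudes in [[0, pi]]; a negative second coordinate calls for the reflected
   longitude [2 * pi - q]. *)
have [b0|b0] := leP 0 b.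
  exists (p, q).
    split => /=; rewrite in_itv/= ?p0//; case/andP: q0 => -> /=; lra.
  apply/coordE; split=> //; first by rewrite cq mulrC divfK.
  by apply/eqP; rewrite -(@eqrXn2 _ 2)// sq.
exists (p, 2 * pi - q).
  by split => /=; rewrite in_itv/= ?p0//; case/andP: q0 => ? ?; apply/andP; lra.
have e : 2 * pi - q = - q + pi *+ 2 by rewrite -mulr_natl; lra.
apply/coordE; rewrite e; split=> //.
  by rewrite cosD2pi cosN cq mulrC divfK.
rewrite sinD2pi sinN mulrN; apply: oppr_inj; rewrite opprK.
by apply/eqP; rewrite -(@eqrXn2 _ 2)// ?sqrrN ?sq// oppr_ge0 ltW.
Qed.

End spherical_coordinates.

(** * Existence and positivity of the maximum of the product *)

Section maximum.
Context {R : realType} (N : nat).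

Lemma continuous_prod (T : topologicalType) (I : Type) (r : seq I) (P : pred I)
    (F : I -> T -> R) :
  (forall i, continuous (F i)) -> continuous (fun x => \prod_(i <- r | P i) F i x).
Proof.
move=> cF; elim: r => [|i r IH].
  rewrite (_ : (fun x => _) = cst 1); first exact: cst_continuous.
  by apply/funext => x; rewrite big_nil.
rewrite (_ : (fun x => _) = fun x => if P i
    then F i x * \prod_(j <- r | P j) F j x else \prod_(j <- r | P j) F j x).
  by case: (P i) => // x; apply: cvgM; [exact: cF|exact: IH].
by apply/funext => x; rewrite big_cons.
Qed.

Lemma sqdist_spherical_coord (t u : R * R) :
  sqdist (spherical_coord t) (spherical_coord u) =
  2 - 2 * (sin t.1 * sin u.1 * cos (t.2 - u.2) + cos t.1 * cos u.1).
Proof.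
by rewrite sphere_sqdist ?dot3_spherical_coord//; exact: sphere_spherical_coord.
Qed.

Lemma continuous_sqdist_spherical_coord (T : topologicalType)
    (f g : T -> R * R) : continuous f -> continuous g ->
  continuous (fun x => sqdist (spherical_coord (f x)) (spherical_coord (g x))).
Proof.
move=> cf cg.
have c1 (h : T -> R * R) : continuous h -> continuous (fun x : T => (h x).1 : R).
  move=> ch x; apply: (@continuous_comp _ _ _ h (@fst R R)); first exact: ch.
  exact: cvg_fst.
have c2 (h : T -> R * R) : continuous h -> continuous (fun x : T => (h x).2 : R).
  move=> ch x; apply: (@continuous_comp _ _ _ h (@snd R R)); first exact: ch.
  exact: cvg_snd.
have cs (h : T -> R) : continuous h -> continuous (fun x : T => sin (h x : R)).
  by move=> ch x; apply: continuous_comp; [exact: ch|exact: continuous_sin].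
have cc (h : T -> R) : continuous h -> continuous (fun x : T => cos (h x : R)).
  by move=> ch x; apply: continuous_comp; [exact: ch|exact: continuous_cos].
under eq_fun do rewrite sqdist_spherical_coord.
move=> x; apply: cvgB; first exact: cvg_cst.
apply: cvgM; first exact: cvg_cst.
apply: cvgD; last by apply: cvgM; apply/cc/c1.
apply: cvgM; first by apply: cvgM; apply/cs/c1.
by apply: cc => y; apply: cvgB; exact: c2.
Qed.

(** The maximum is taken over angles: the product of the coordinate rectangles is compact by
    Tychonoff, the objective is continuous in the angles, and every spherical configuration has
    angles. *)
Lemma exists_pair_prod_max : exists2 c : 'I_N -> R3 R,
  (forall i, sphere (c i)) &
  forall d : 'I_N -> R3 R, (forall i, sphere (d i)) -> pair_prod d <= pair_prod c.
Proof.
pose T := prod_topology (fun _ : 'I_N => (R * R)%type).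
pose A : set T := [set f | forall i, spherical_dom (f i)].
pose G : T -> R := fun f => pair_prod (fun i => spherical_coord (f i)).
have cA : compact A.
  apply: (@tychonoff _ (fun=> (R * R)%type) (fun=> @spherical_dom R)) => i.
  by apply: compact_setX; exact: segment_compact.
have A0 : A !=set0.
  exists (fun=> (0, 0)) => i; split => /=; rewrite in_itv/= lexx/= ?pi_ge0//.
  by rewrite mulr_ge0// pi_ge0.
have cG : continuous G.
  have cp i : continuous (fun f : T => f i).
    exact: (@proj_continuous _ (fun=> (R * R)%type) i).
  by apply: continuous_prod => i; apply: continuous_prod => j;
    exact: continuous_sqdist_spherical_coord.
have [f fA fmax] := compact_EVT_max A0 cA (continuous_subspaceT cG).
exists (fun i => spherical_coord (f i)) => [i|d sd].
  exact: sphere_spherical_coord.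
have /choice[g gP] : forall i, exists t : R * R,
    spherical_dom t /\ spherical_coord t = d i.
  by move=> i; have [t ? ?] := spherical_coord_surj (sd i); exists t.
have -> : d = fun i => spherical_coord (g i).
  by apply/funext => i; have [_ ->] := gP i.
by apply: (fmax (g : T)); rewrite inE => i; have [] := gP i.
Qed.

Lemma exists_pair_prod_gt0 : exists2 c : 'I_N -> R3 R,
  (forall i, sphere (c i)) & 0 < pair_prod c.
Proof.
(* Points on one meridian with colatitudes [i / N] in [[0, pi]]; their third coordinates differ
   because [cos] is injective there. *)
exists (fun i => spherical_coord (i%:R / N%:R, 0)).
  by move=> i; exact: sphere_spherical_coord.
apply: prodr_gt0 => i _; apply: prodr_gt0 => j ij.
rewrite lt_neqAle sqdist_ge0 andbT eq_sym; apply/eqP => /sqdist_eq0.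
move/(congr1 (fun x : R3 R => (tnth x (lift ord0 (lift ord0 ord0)) : R))).
rewrite !(tnth_nth 0)/=.
have I k : (k < N)%N -> k%:R / N%:R \in `[(0:R), pi].
  move=> kN; have N0 : 0 < N%:R :> R by rewrite ltr0n (leq_ltn_trans _ kN).
  rewrite in_itv/= divr_ge0//= ler_pdivrMr//.
  have := pi_ge2 R; have : k%:R < N%:R :> R by rewrite ltr_nat.
  nra.
move/cos_inj => /(_ (I _ (ltn_ord i)) (I _ (ltn_ord j))).
have N0 : N%:R != 0 :> R by rewrite pnatr_eq0; case: (N) i {j ij I} => // -[].
move=> /(mulIf (invr_neq0 N0))/eqP; rewrite eqr_nat => /eqP.
by move=> e; move: ij; rewrite e ltnn.
Qed.

End maximum.

(** * Measure of spherical caps *)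

Section spherical_caps.
Context {R : realType}.
Implicit Types (x y : R3 R) (a b p q c u : R).

Definition cap x a : set (R3 R) := [set y | sphere y /\ cos a <= dot3 x y].

Lemma measurable_coord k : measurable_fun setT (fun x : R3 R => tnth x k : R).
Proof. exact: measurable_tnth. Qed.

Lemma measurable_sphere : measurable (@sphere R).
Proof.
have -> : @sphere R = (fun x => dot3 x x) @^-1` [set 1].
  by apply/seteqP; split => x /sphereP.
rewrite -[X in measurable X]setTI.
suff mf : measurable_fun setT (fun x : R3 R => dot3 x x).
  exact: (mf measurableT _ (measurable_set1 _)).
by apply: measurable_sum => k; apply: measurable_funM; exact: measurable_coord.
Qed.

Lemma measurable_cap x a : measurable (cap x a).
Proof.
have -> : cap x a = sphere `&` (dot3 x @^-1` `[cos a, +oo[).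
  by apply/seteqP; split => y; rewrite /cap/= in_itv/= andbT.
apply: measurableI; first exact: measurable_sphere.
rewrite -[X in measurable X]setTI.
suff mf : measurable_fun setT (dot3 x) by exact: (mf measurableT _ (measurable_itv _)).
by apply: measurable_sum => k; apply: measurable_funM => //; exact: measurable_coord.
Qed.

(** The integral defining the area is restricted to a coordinate rectangle that maps into [A], where
    the density is at least [c]. *)
Lemma surface_measure_ge_rectangle (A : set (R3 R)) a b p q c :
  measurable A -> 0 <= a -> a <= b -> b <= pi -> 0 <= p -> p <= q ->
  q <= 2 * pi -> 0 <= c ->
  (forall s t, a <= s <= b -> p <= t <= q ->
     c <= sin s /\ A (spherical_coord (s, t))) ->
  ((c * ((b - a) * (q - p)))%:E <= surface_measure R A)%E.
Proof.
move=> mA a0 ab bpi p0 pq q2 c0 H.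
pose Q : set (measurableTypeR R * measurableTypeR R) := `[a, b] `*` `[p, q].
have mQ : measurable Q by apply: measurableX; exact: measurable_itv.
have mD : measurable (spherical_dom `&` spherical_coord @^-1` A).
  apply: measurableI; first exact: measurable_spherical_dom.
  rewrite -[X in measurable X]setTI.
  exact: measurable_spherical_coord.
have QD : Q `<=` spherical_dom `&` spherical_coord @^-1` A.
  move=> [s t] [/=]; rewrite !in_itv/= => sI tI; have [_ As] := H _ _ sI tI.
  move: sI tI => /andP[? ?] /andP[? ?]; split=> //; split => /=.
    by rewrite in_itv/=; apply/andP; split; lra.
  by rewrite in_itv/=; apply/andP; split; lra.
have mQE : (lebesgue_measure \x lebesgue_measure)%E Q =
    ((b - a) * (q - p))%:E.
  have mI (x y : R) : x <= y ->
      (lebesgue_measure (`[x, y] : set (measurableTypeR R)) = (y - x)%:E)%E.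
    move=> xy; rewrite lebesgue_measure_itv/= lte_fin; case: ltP => [//|yx].
    by congr EFin; lra.
  by rewrite product_measure1E/= ?mI//; exact: measurable_itv.
rewrite EFinM -mQE -integral_cst//.
apply: (@le_trans _ _ (\int[lebesgue_measure \x lebesgue_measure]_(t in Q)
   (sin t.1)%:E)%E).
  apply: ge0_le_integral => //.
  - by apply: measurable_funTS; exact: measurable_sin_fst.
  - move=> [s t] [/=]; rewrite !in_itv/= => sI tI; rewrite lee_fin.
    by have [] := H _ _ sI tI.
apply: ge0_subset_integral => //.
- by apply: measurable_funTS; exact: measurable_sin_fst.
- by move=> t [/sin_spherical_dom_ge0].
Qed.

(* [sin s0 |t - t0| <= d] keeps the rectangle within chord distance [2 d] of
   [(s0, t0)].  Close to the pole the longitude is unrestricted, and the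
   latitudes below [s0 + d / 2], where the area density is small, are dropped. *)
Lemma angle_rectangle_pihalf (s0 t0 d : R) : 0 <= s0 <= pi / 2 ->
  0 <= t0 <= 2 * pi -> 0 < d <= 1 / 3 ->
  exists a b p q c, [/\ [/\ s0 <= a, a <= b & b <= s0 + d],
   [/\ 0 <= p, p <= q & q <= 2 * pi],
   [/\ 0 <= c & forall s, a <= s <= b -> c <= sin s],
   (forall t, p <= t <= q -> sin s0 * `|t - t0| <= d) &
   4 * pi * (d ^+ 2 / 14) <= c * ((b - a) * (q - p))].
Proof.
move=> /andP[s00 s0p] /andP[t00 t02] /andP[d0 d3].
have pi2 := pi_ge2 R; have pi3 := @pi_le R.
set S := sin s0; pose C := cos s0.
have S0 : 0 <= S by rewrite sin_ge0_pi// s00; lra.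
have C0 : 0 <= C by rewrite cos_ge0_pihalf// s0p andbT; lra.
have SC : C ^+ 2 + S ^+ 2 = 1 by exact: cos2Dsin2.
(* The constant [17 / 18] is [1 - d^2 / 2] at the largest admissible [d = 1 / 3]. *)
have sv v : 0 <= v <= d -> 17 / 18 * v <= sin v.
  move=> /andP[v0 vd]; have v1 : v <= d by [].
  have := @sin_ge_cosM R v d v0 v1; move=> /(_ _)H.
  have : (1 - d ^+ 2 / 2) * v <= sin v by apply: H; lra.
  apply: le_trans; rewrite ler_wpM2r//; nra.
have cv v : 0 <= v <= d -> 17 / 18 <= cos v.
  move=> /andP[v0 vd]; apply: le_trans (cos_ge v); nra.
have sE s : sin s = S * cos (s - s0) + C * sin (s - s0).
  by rewrite -sinD addrC subrK.
(* The split is on whether the longitude half-width [d / S] is at most a full turn. *)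
have [dS|Sd] := leP d (2 * pi * S).
  have Sp : 0 < S by nra.
  pose w := d / S.
  have wS : w * S = d by rewrite /w divfK// gt_eqF.
  have w0 : 0 <= w by rewrite /w divr_ge0// ltW.
  have w2 : w <= 2 * pi by nra.
  (* The interval [[p, p + w]] starts at [t0] unless it would then leave [[0, 2 pi]]; it is shifted
     left in that case and still contains [t0]. *)
  pose p := Num.min t0 (2 * pi - w).
  have pt0 : p <= t0 by rewrite /p ge_min lexx.
  have p2 : p <= 2 * pi - w by rewrite /p ge_min lexx orbT.
  have p0 : 0 <= p by rewrite /p le_min t00/=; lra.
  have t0q : t0 <= p + w by rewrite -lerBlDr /p le_min; apply/andP; split; lra.
  exists s0, (s0 + d), p, (p + w), (17 / 18 * S); split.
  - by split; lra.
  - by split; lra.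
  - split; first by rewrite mulr_ge0//; lra.
    move=> s /andP[sa sb].
    have vI : 0 <= s - s0 <= d by apply/andP; split; lra.
    rewrite sE; have := sv _ vI; have := cv _ vI; move: vI => /andP[v0 _].
    move: (cos _) (sin _) => cc ss; nra.
  - move=> t /andP[pt tq]; rewrite -wS mulrC ler_wpM2r//.
    by rewrite ler_norml; apply/andP; split; lra.
  - have -> : 17 / 18 * S * ((s0 + d - s0) * (p + w - p)) =
        17 / 18 * d * (w * S) by ring.
    (* What remains is [4 pi / 14 <= 17 / 18], which the bound [pi <= 16 / 5] provides. *)
    rewrite wS; nra.
(* Here [S] is at most [1 / 12], so [C >= 9 / 10], and [sin s] is at least [9 / 10 * (17 / 36 * d)],
   which exceeds [2 / 5 * d]. *)
exists (s0 + d / 2), (s0 + d), 0, (2 * pi), (2 / 5 * d); split.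
- by split; lra.
- by split; lra.
- split; first by rewrite mulr_ge0//; lra.
  move=> s /andP[sa sb].
  have vI : 0 <= s - s0 <= d by apply/andP; split; lra.
  have S12 : S <= 1 / 12 by nra.
  have C9 : 9 / 10 <= C by nra.
  rewrite sE; have := sv _ vI; have := cv _ vI; move: vI => /andP[v0 _].
  have v2 : d / 2 <= s - s0 by lra.
  move: (cos _) (sin _) v2 => cc ss v2 c1 s1.
  have h1 : 17 / 36 * d <= ss by lra.
  have h2 : 9 / 10 * (17 / 36 * d) <= C * ss by apply: ler_pM => //; lra.
  have h3 : 0 <= S * cc by rewrite mulr_ge0//; lra.
  lra.
- move=> t /andP[t1 t2].
  have : `|t - t0| <= 2 * pi by rewrite ler_norml; apply/andP; split; lra.
  have := normr_ge0 (t - t0); move: `|_| => z; nra.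
- have -> : 2 / 5 * d * ((s0 + d - (s0 + d / 2)) * (2 * pi - 0)) =
     2 / 5 * (pi * d ^+ 2) by field.
  have : 0 <= pi * d ^+ 2 by rewrite mulr_ge0 ?sqr_ge0//; lra.
  lra.
Qed.

Lemma sin_piB (s : R) : sin (pi - s) = sin s.
Proof. by rewrite sinB sinpi cospi mul0r sub0r mulN1r opprK. Qed.

(** The reflection [s -> pi - s] preserves the sine and carries the southern hemisphere to the
    northern one. The upper bound on [sin s] serves to control the inner product in
    [uniform_sphere_cap]. *)
Lemma angle_rectangle (s0 t0 d : R) : 0 <= s0 <= pi ->
  0 <= t0 <= 2 * pi -> 0 < d <= 1 / 3 ->
  exists a b p q c,
   [/\ [/\ 0 <= a, a <= b, b <= pi &
          forall s, a <= s <= b -> `|s - s0| <= d /\ sin s <= sin s0 + d],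
   [/\ 0 <= p, p <= q & q <= 2 * pi],
   [/\ 0 <= c & forall s, a <= s <= b -> c <= sin s],
   (forall t, p <= t <= q -> sin s0 * `|t - t0| <= d) &
   4 * pi * (d ^+ 2 / 14) <= c * ((b - a) * (q - p))].
Proof.
move=> /andP[s00 s0p] t0I dI; have /andP[d0 d3] := dI; have pi2 := pi_ge2 R.
have [sp|sp] := leP s0 (pi / 2).
  have s0I : 0 <= s0 <= pi / 2 by rewrite s00.
  have [a [b [p [q [c [[sa ab bs] pqI cI tI H]]]]]] :=
    angle_rectangle_pihalf s0I t0I dI.
  exists a, b, p, q, c; split=> //; split=> //; [lra|lra|move=> s /andP[as_ sb]].
  split; first by rewrite ler_norml; apply/andP; split; lra.
  by have := @sinB_le R s0 s; lra.
have s0I : 0 <= pi - s0 <= pi / 2 by apply/andP; split; lra.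
have [a [b [p [q [c [[sa ab bs] pqI [c0 cI] tI H]]]]]] :=
  angle_rectangle_pihalf s0I t0I dI.
rewrite sin_piB in tI.
exists (pi - b), (pi - a), p, q, c; split=> //.
- split; [lra|lra|lra|move=> s /andP[as_ sb]].
  split; first by rewrite ler_norml; apply/andP; split; lra.
  by have := @sinB_le R (pi - s0) (pi - s); rewrite !sin_piB; lra.
- split=> // s sI; rewrite -sin_piB; apply: cI.
  by case/andP: sI => ? ?; apply/andP; split; lra.
- by have -> : pi - a - (pi - b) = b - a by lra.
Qed.

(** With [d = 17 / 18 * u <= sin u], one has [cos (2 u) <= 1 - 2 d^2], so inner products of at least
    [1 - 2 d^2] suffice. With [X = 1 - cos (t - t0)], the inner product is
    [cos (s - s0) - sin s sin s0 X]. The first term loses at most [d^2 / 2]. As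
    [sin s <= sin s0 + d], the second loses at most [d^2 / 2 + d^2], by the quadratic and the linear
    bound on [X]. *)
Lemma uniform_sphere_cap x u : sphere x -> 0 < u <= 1 / 3 ->
  (((17 / 18 * u) ^+ 2 / 14)%:E <= uniform_sphere R (cap x (2 * u)))%E.
Proof.
move=> /spherical_coord_surj[[s0 t0] [/= s0I t0I] <-] /andP[u0 u3].
have u2 : u ^+ 2 <= 1 / 9.
  have -> : 1 / 9 = (1 / 3) ^+ 2 :> R by field.
  by rewrite ler_sqr ?nnegrE; lra.
set d := 17 / 18 * u.
have dI : 0 < d <= 1 / 3 by rewrite /d; apply/andP; split; lra.
rewrite !in_itv/= in s0I t0I.
have [a [b [p [q [c [[a0 ab bpi sI] [p0 pq q2] [c0 cI] tI H]]]]]] :=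
  angle_rectangle s0I t0I dI.
have pi0 := pi_gt0 R; have /andP[d0 d3] := dI.
have su : d <= sin u.
  apply: (@le_trans _ _ ((1 - u ^+ 2 / 2) * u)).
    by rewrite /d (ler_wpM2r (ltW u0))//; lra.
  by apply: sin_ge_cosM; lra.
have cu : cos (2 * u) <= 1 - 2 * d ^+ 2.
  rewrite mulr_natl cos_mulr2n cos2sin2 -mulr_natl.
  have : d ^+ 2 <= sin u ^+ 2 by rewrite ler_sqr ?nnegrE; lra.
  lra.
have S0 : 0 <= sin s0 by exact: sin_ge0_pi.
have sub : ((c * ((b - a) * (q - p)))%:E <=
    surface_measure R (cap (spherical_coord (s0, t0)) (2 * u)))%E.
  apply: surface_measure_ge_rectangle => //; first exact: measurable_cap.
  move=> s t sI' tI'; split; first exact: cI.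
  split; first exact: sphere_spherical_coord.
  rewrite dot3_spherical_coord/=; apply: (le_trans cu).
  have [sd ss] := sI _ sI'; have td := tI _ tI'.
  have sin0 : 0 <= sin s.
    by apply: sin_ge0_pi; case/andP: sI' => ? ?; apply/andP; split; lra.
  have e : cos s0 * cos s = cos (s - s0) - sin s * sin s0 by rewrite cosB; ring.
  rewrite e -[t0 - t]opprB cosN.
  have h1 : 1 - d ^+ 2 / 2 <= cos (s - s0).
    apply: le_trans (cos_ge _).
    have : (s - s0) ^+ 2 <= d ^+ 2.
      by rewrite -[(s - s0) ^+ 2]real_normK ?num_real// ler_sqr ?nnegrE// ltW.
    lra.
  have h2 := one_sub_cos_le_norm (t - t0).
  have h3 := cos_ge (t - t0).
  have h4 : 0 <= 1 - cos (t - t0) by rewrite subr_ge0 cos_le1.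
  set X := 1 - cos (t - t0) in h2 h4.
  have cX : cos (t - t0) = 1 - X by rewrite /X; lra.
  have h3' : X <= `|t - t0| ^+ 2 / 2 by rewrite real_normK ?num_real// /X; lra.
  rewrite cX; move: `|t - t0| (normr_ge0 (t - t0)) => z z0 in td h2 h3' *.
  have S1 : sin s0 * X <= d by apply: le_trans td; rewrite ler_wpM2l.
  have S2 : sin s0 * (sin s0 * X) <= d ^+ 2 / 2.
    apply: (@le_trans _ _ ((sin s0 * z) ^+ 2 / 2)).
      have -> : (sin s0 * z) ^+ 2 / 2 = sin s0 * (sin s0 * (z ^+ 2 / 2)) by field.
      by rewrite !ler_wpM2l.
    by rewrite ler_wpM2r// ler_sqr ?nnegrE ?mulr_ge0// ltW.
  have S3 : sin s * (sin s0 * X) <= (sin s0 + d) * (sin s0 * X).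
    by rewrite ler_wpM2r// mulr_ge0.
  have S4 : d * (sin s0 * X) <= d * d by rewrite ler_wpM2l// ltW.
  move: S1 S2 S3 S4 h1; rewrite [d ^+ 2]expr2.
  move: (cos (s - s0)) (sin s) (sin s0) => k1 k2 k3; lra.
have -> : (d ^+ 2 / 14)%:E = ((4 * pi)^-1%:E * (4 * pi * (d ^+ 2 / 14))%:E)%E.
  by rewrite -EFinM mulKf// mulf_neq0// gt_eqF.
apply: lee_wpmul2l.
  by rewrite lee_fin invr_ge0 mulr_ge0// ltW.
by apply: le_trans sub; rewrite lee_fin.
Qed.

End spherical_caps.

(** * Product measures and Gibbs measures *)

Section power_probability_theory.
Context d (T : measurableType d) (R : realType) (P : probability T R).
Local Open Scope ereal_scope.

Lemma measurable_tuple_box n (A : 'I_n -> set T) :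
  (forall i, measurable (A i)) ->
  measurable [set x : n.-tuple T | forall i, A i (tnth x i)].
Proof.
move=> mA.
rewrite (_ : [set x | _] = \bigcap_(i in setT) ((@tnth n T)^~ i @^-1` A i)).
  apply: fin_bigcap_measurable => // i _; rewrite -[X in measurable X]setTI.
  exact: measurable_tnth.
by apply/seteqP; split => x /= xA i; [move=> _|]; exact: xA.
Qed.

Lemma power_probability_box n (A : 'I_n -> set T) :
  (forall i, measurable (A i)) ->
  power_probability P n [set x | forall i, A i (tnth x i)] =
  \prod_(i < n) P (A i).
Proof.
elim: n A => [|n IH] A mA.
  rewrite big_ord0 /= diracE mem_set// => -[].
  by case.
rewrite big_ord_recl -IH//= /pushforward.
rewrite (_ : _ @^-1` _ = A ord0 `*`
    [set x : n.-tuple T | forall i, A (lift ord0 i) (tnth x i)]).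
  rewrite product_measure1E//.
  exact: (@measurable_tuple_box n (fun i => A (lift ord0 i))).
apply/seteqP; split => -[y x] /=.
  move=> H; split; first by have := H ord0; rewrite tnth0.
  by move=> i; have := H (lift ord0 i); rewrite tnthS.
move=> [Ay Ax] i; case: (unliftP ord0 i) => [j|] ->.
  by rewrite tnthS.
by rewrite tnth0.
Qed.

End power_probability_theory.

(** * Tail and entropy bounds for a probability with density [f / Z] *)

Section gibbs.
Context d (T : measurableType d) (R : realType).
Variables (mu nu : probability T R) (f : T -> R) (Z : R).
Hypotheses (mf : measurable_fun setT f) (f0 : forall x, 0 <= f x) (Z0 : 0 < Z).
Hypothesis intf : (\int[mu]_x (f x)%:E = Z%:E)%E.
Hypothesis nuE : forall A, measurable A ->
  (nu A = Z^-1%:E * \int[mu]_(x in A) (f x)%:E)%E.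

Let mEf : measurable_fun setT (EFin \o f).
Proof. exact/measurable_EFinP. Qed.

(** On this set the density of [nu] is below [e / Z], and [mu] has total mass 1. *)
Lemma gibbs_tail e : 0 <= e -> (nu [set x | (f x < e)%R] <= (e / Z)%:E)%E.
Proof.
move=> e0; have mA : measurable [set x | (f x < e)%R].
  rewrite (_ : [set x | _] = setT `&` f @^-1` `]-oo, e[%classic).
    by apply: mf => //; exact: measurable_itv.
  by rewrite setTI; apply/seteqP; split => x; rewrite /= in_itv.
rewrite nuE// mulrC EFinM; apply: lee_wpmul2l.
  by rewrite lee_fin invr_ge0 ltW.
apply: (@le_trans _ _ (\int[mu]_(x in [set x | (f x < e)%R]) (cst e%:E x))%E).
  apply: ge0_le_integral => //.
  - by move=> x _; rewrite lee_fin.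
  - exact: measurable_funTS.
  - by move=> x /= xe; rewrite lee_fin ltW.
rewrite integral_cst// -[leRHS]mule1; apply: lee_wpmul2l; first by rewrite lee_fin.
exact: probability_le1.
Qed.

(** [nuE] speaks of sets only. The passage to functions is by change of variables, once the
    Radon-Nikodym derivative is identified almost everywhere with [f / Z]. *)
Lemma gibbs_integral (g : T -> \bar R) : measurable_fun setT g ->
  (forall x, 0 <= g x)%E ->
  (\int[nu]_x g x = Z^-1%:E * \int[mu]_x (g x * (f x)%:E))%E.
Proof.
move=> mg g0; have Zi : 0 <= Z^-1 by rewrite invr_ge0 ltW.
have numu : nu `<< mu.
  apply/null_content_dominatesP => A mA muA0.
  rewrite nuE// null_set_integral ?mule0//.
  exact: measurable_funTS.
rewrite -(Radon_Nikodym_SigmaFinite.change_of_variables numu)//.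
rewrite -ge0_integralZl//; last 2 first.
- by apply: emeasurable_funM.
- by move=> x _; rewrite mule_ge0// lee_fin.
set k := Radon_Nikodym_SigmaFinite.f _ _.
have ik : mu.-integrable setT k.
  exact: Radon_Nikodym_SigmaFinite.f_integrable.
apply: ae_eq_integral => //.
- by apply: emeasurable_funM => //; exact: measurable_int ik.
- by apply: measurable_funeM; exact: emeasurable_funM.
have kf : ae_eq mu setT k (fun x => Z^-1%:E * (f x)%:E)%E.
  apply: integral_ae_eq => //; first exact: measurable_funeM.
  move=> A _ mA; rewrite -Radon_Nikodym_SigmaFinite.f_integral//.
  rewrite ge0_integralZl//; first exact: nuE.
  - exact: measurable_funTS.
  - by move=> x _; rewrite lee_fin.
by apply: filterS kf => x H _; rewrite H// muleCA.
Qed.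

(** The cutoff makes [ln (B / f)] real-valued and nonnegative everywhere. If [f <= B] almost
    everywhere, it changes values only on a null set of the Gibbs measure. *)
Definition log_gap B x :=
  if (0 < f x) && (f x <= B) then ln B - ln (f x) else 0.

Lemma log_gap_ge0 B x : 0 <= log_gap B x.
Proof.
rewrite /log_gap; case: ifPn => // /andP[fx fxB].
by rewrite subr_ge0 ler_ln// posrE (lt_le_trans fx).
Qed.

Lemma measurable_log_gap B : measurable_fun setT (log_gap B).
Proof.
apply: measurable_fun_ifT => //.
  apply: measurable_and; first exact: measurable_fun_ltr.
  exact: measurable_fun_ler.
by apply: measurable_funB => //; exact: measurableT_comp.
Qed.

(* This is the nonnegativity of the relative entropy of [nu] with respect to
   [mu], in the form [f ln (Z / f) <= Z - f]. *)
Lemma gibbs_entropy B : Z <= B -> (\forall x \ae mu, f x <= B) ->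
  (\int[nu]_x (log_gap B x)%:E <= (ln B - ln Z)%:E)%E.
Proof.
move=> ZB fB; have B0 : 0 < B by exact: lt_le_trans ZB.
set h := log_gap B; have h0 := log_gap_ge0 B.
have mh : measurable_fun setT h by exact: measurable_log_gap.
have L0 : 0 <= ln B - ln Z by rewrite subr_ge0 ler_ln.
rewrite gibbs_integral//; last exact/measurable_EFinP.
have mhf : measurable_fun setT (fun x => ((h x)%:E * (f x)%:E)%E).
  by apply: emeasurable_funM => //; exact/measurable_EFinP.
(* Adding [f] to both sides keeps all integrands nonnegative; its integral [Z] cancels
   afterwards. *)
have : (\int[mu]_x ((h x)%:E * (f x)%:E + (f x)%:E) <=
        \int[mu]_x ((ln B - ln Z)%:E * (f x)%:E + cst Z%:E x))%E.
  apply: ae_ge0_le_integral => //.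
  - by move=> x _; rewrite adde_ge0 ?mule_ge0 ?lee_fin.
  - exact: emeasurable_funD.
  - by move=> x _; rewrite adde_ge0 ?mule_ge0 ?lee_fin// ltW.
  - by apply: emeasurable_funD => //; exact: measurable_funeM.
  - apply: filterS fB => x fxB _; rewrite -!EFinM -!EFinD lee_fin /h /log_gap fxB andbT.
    have [fx|fx] := ltP 0 (f x); last first.
      have -> : f x = 0 by apply/le_anti; rewrite fx f0.
      by rewrite !mulr0 !add0r ltW.
    have : ln (Z / f x) <= Z / f x - 1.
      have := @le_ln1Dx R (Z / f x - 1); rewrite [1 + _]addrC subrK; apply.
      by rewrite ltrBrDl addrN divr_gt0.
    rewrite ln_div// => H.
    have := ler_wpM2r (f0 x) H; rewrite !mulrBl divfK ?gt_eqF//; lra.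
rewrite ge0_integralD//; last 2 first.
- by move=> x _; rewrite mule_ge0 ?lee_fin.
- by move=> x _; rewrite lee_fin.
rewrite ge0_integralD//; last 3 first.
- by move=> x _; rewrite mule_ge0 ?lee_fin.
- exact: measurable_funeM.
- by move=> x _; rewrite lee_fin ltW.
rewrite ge0_integralZl//; last by move=> x _; rewrite lee_fin.
rewrite integral_cst// [X in (_ + _ * X)%E](_ : _ = 1%E) ?mule1; last first.
  exact: probability_setT.
rewrite intf leeD2rE//.
move=> H; apply: (@le_trans _ _ (Z^-1%:E * ((ln B - ln Z)%:E * Z%:E))%E).
  by apply: lee_wpmul2l => //; rewrite lee_fin invr_ge0 ltW.
by rewrite -!EFinM lee_fin mulrCA mulVf ?mulr1// gt_eqF.
Qed.

End gibbs.

(** * The logarithmic energy and the partition function *)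

Section energy.
Context {R : realType}.

Lemma ln_prod (I : eqType) (r : seq I) (P : pred I) (F : I -> R) :
  (forall i, P i -> 0 < F i) ->
  ln (\prod_(i <- r | P i) F i) = \sum_(i <- r | P i) ln (F i).
Proof.
move=> F0; elim: r => [|i r IH]; first by rewrite !big_nil ln1.
rewrite !big_cons; case: ifPn => // Pi.
by rewrite lnM ?IH// posrE ?F0// prodr_gt0.
Qed.

Lemma sum_offdiag_sym N (a : 'I_N -> 'I_N -> R) : (forall i j, a i j = a j i) ->
  \sum_(i < N) \sum_(j < N | i != j) a i j =
  2 * \sum_(i < N) \sum_(j < N | (i < j)%N) a i j.
Proof.
move=> aC; transitivity (\sum_(i < N) (\sum_(j < N | (i < j)%N) a i j +
    \sum_(j < N | (j < i)%N) a i j)).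
  apply: eq_bigr => i _; rewrite (bigID (fun j : 'I_N => (i < j)%N))/=.
  by congr (_ + _); apply: eq_bigl => j; rewrite -val_eqE/=; case: ltngtP.
rewrite big_split/= [X in _ + X](exchange_big_dep xpredT)//=.
rewrite mulr_natl mulr2n; congr (_ + _).
by apply: eq_bigr => i _; apply: eq_bigr => j _.
Qed.

(** The two orderings of a pair together contribute [- ln] of its squared distance, whence the
    squares in [pair_prod]. The product vanishes exactly when two points coincide, which is when the
    energy is infinite. *)
Lemma log_energyE N (x : N.-tuple (R3 R)) : log_energy x =
  if pair_prod (tnth x) == 0 then +oo%E else (- ln (pair_prod (tnth x)))%:E.
Proof.
pose s i j := norm3 (sub3 (tnth x i) (tnth x j)).
have s2 i j : s i j ^+ 2 = sqdist (tnth x i) (tnth x j).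
  by rewrite /s norm3_sub3 sqr_sqrtr// sqdist_ge0.
have s_ge0 i j : 0 <= s i j by exact: sqrtr_ge0.
have sC i j : s i j = s j i by rewrite /s !norm3_sub3 sqdistC.
have termE i j : lne (s i j)%:E^-1 =
    if s i j == 0 then +oo%E else (- ln (s i j))%:E.
  rewrite inver; case: ifPn => // s0.
  have sp : 0 < s i j by rewrite lt_neqAle eq_sym s0 s_ge0.
  by rewrite lne_EFin ?invr_gt0// lnV// posrE.
have termNy i j : lne (s i j)%:E^-1 != -oo%E by rewrite termE; case: ifP.
rewrite /log_energy.
have [[i [j [ij sij]]]|s_neq0] := pselect (exists i j, i != j /\ s i j = 0).
  have ijx : sqdist (tnth x i) (tnth x j) = 0 by rewrite -s2 sij expr0n.
  have -> : pair_prod (tnth x) = 0.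
    rewrite /pair_prod; have [ltij|ltji|e] := ltngtP i j.
    - by rewrite (bigD1 i)//= (bigD1 j)//= ijx !mul0r.
    - by rewrite (bigD1 j)//= (bigD1 i)//= sqdistC ijx !mul0r.
    - by move/val_inj : e ij => ->; rewrite eqxx.
  rewrite eqxx; apply/eqP; rewrite esum_eqy.
    apply/existsP; exists i; rewrite /= esum_eqy; last by move=> k _; exact: termNy.
    by apply/existsP; exists j; apply/andP; split; rewrite // -/(s i j) termE sij eqxx.
  move=> k _; apply/eqP => /esum_eqNyP[l [_ _ /eqP]].
  by rewrite -/(s k l) (negbTE (termNy k l)).
have sp i j : i != j -> 0 < s i j.
  move=> ij; rewrite lt_neqAle eq_sym s_ge0 andbT; apply/eqP => sij.
  by apply: s_neq0; exists i, j.
have qp (i j : 'I_N) : (i < j)%N -> 0 < sqdist (tnth x i) (tnth x j).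
  by move=> ij; rewrite -s2 exprn_gt0// sp// -val_eqE/= ltn_eqF.
have Fp : 0 < pair_prod (tnth x).
  by apply: prodr_gt0 => i _; apply: prodr_gt0 => j ij; exact: qp.
rewrite gt_eqF//.
transitivity ((\sum_(i < N) \sum_(j < N | i != j) - ln (s i j))%:E).
  rewrite -sumEFin; apply: eq_bigr => i _; rewrite -sumEFin; apply: eq_bigr => j ij.
  by rewrite -/(s i j) termE gt_eqF// sp.
congr EFin; rewrite sum_offdiag_sym; last by move=> i j; rewrite sC.
rewrite /pair_prod ln_prod; last by move=> i _; apply: prodr_gt0 => j; exact: qp.
rewrite mulr_sumr -sumrN; apply: eq_bigr => i _.
rewrite ln_prod; last by move=> j; exact: qp.
rewrite mulr_sumr -sumrN; apply: eq_bigr => j ij.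
rewrite -s2 lnXn; last by apply: sp; rewrite -val_eqE/= ltn_eqF.
by rewrite mulrN mulr_natl.
Qed.

Lemma boltzmannE N k (x : N.-tuple (R3 R)) : (0 < k)%N ->
  boltzmann k%:R x = (pair_prod (tnth x) ^+ k)%:E.
Proof.
move=> k0; rewrite /boltzmann log_energyE; case: ifPn => [/eqP ->|F0].
  (* Positivity of [k] is what makes [k * +oo] infinite and [0 ^+ k] zero. *)
  by rewrite expr0n gtn_eqF// mulry gtr0_sg ?ltr0n// mul1e.
have Fp : 0 < pair_prod (tnth x) by rewrite lt_neqAle eq_sym F0 pair_prod_ge0.
by rewrite /= mulrN opprK expRM_natl lnK.
Qed.

End energy.

(** A positive finite total mass keeps [mnormalize] away from its fallback. *)
Lemma mnormalizeE d (T : measurableType d) (R : realType)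
    (m : {measure set T -> \bar R}) (P : probability T R) (z : R) (A : set T) :
  0 < z -> m setT = z%:E -> mnormalize m P A = (z^-1%:E * m A)%E.
Proof.
by move=> z0 mz; rewrite /mnormalize/= mz eqe gt_eqF//= muleC.
Qed.

Lemma ler_prod_EFin (R : realType) (N : nat) (r : R) (b : 'I_N -> \bar R) : 0 <= r ->
  (forall i, r%:E <= b i)%E -> ((r ^+ N)%:E <= \prod_(i < N) b i)%E.
Proof.
move=> r0 rb; have -> : (r ^+ N)%:E = (\prod_(i < N) r%:E)%E.
  by rewrite prodEFin prodr_const card_ord.
suff : (0 <= \prod_(i < N) r%:E <= \prod_(i < N) b i)%E by case/andP.
elim/big_rec2 : _ => [|i x y _ /andP[y0 yx]]; first by rewrite lexx lee01.
by rewrite mule_ge0 ?lee_fin//= lee_pmul ?lee_fin.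
Qed.

(** * Two-sided bounds on the partition function at inverse temperature [N] *)

Section partition_function.
Context {R : realType}.
Variable N : nat.
Hypothesis hN : (2 <= N)%N.
Local Notation mu := (power_probability (uniform_sphere R) N).

Definition pair_power (x : N.-tuple (R3 R)) : R := pair_prod (tnth x) ^+ N.

Let N0 : (0 < N)%N. Proof. exact: ltn_trans hN. Qed.

Lemma pair_power_ge0 x : 0 <= pair_power x.
Proof. by rewrite exprn_ge0// pair_prod_ge0. Qed.

Lemma boltzmann_pair_power : boltzmann N%:R = (fun x => (pair_power x)%:E).
Proof. by apply/funext => x; exact: boltzmannE. Qed.

Lemma measurable_pair_power : measurable_fun setT pair_power.
Proof.
apply/measurable_EFinP.
have := @measurable_boltzmann R N N%:R.
by rewrite boltzmann_pair_power.
Qed.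

Lemma measurable_sphereN : measurable (sphereN R N).
Proof.
apply: (@measurable_tuple_box _ _ N (fun=> sphere)) => i.
exact: measurable_sphere.
Qed.

Lemma power_sphereN : (mu (sphereN R N) = 1)%E.
Proof.
rewrite (power_probability_box _ (A := fun=> sphere)); last first.
  by move=> i; exact: measurable_sphere.
by rewrite big1// => i _; exact: uniform_sphere_sphere.
Qed.

Lemma power_sphereNC : (mu (~` sphereN R N) = 0)%E.
Proof.
rewrite probability_setC; last exact: measurable_sphereN.
by rewrite power_sphereN subee.
Qed.

Variable c : 'I_N -> R3 R.
Hypothesis sc : forall i, sphere (c i).
Hypothesis cmax : forall d : 'I_N -> R3 R, (forall i, sphere (d i)) ->
  pair_prod d <= pair_prod c.
Hypothesis c0 : 0 < pair_prod c.

(* [17 / 18 * u] squared over 14 bounds the measure of a cap from below, and the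
   factor 3 is the loss on [pair_prod]. *)
Lemma cap_weight_ge (u : R) : u = 2 / (3 * (N * N.-1)%:R) ->
  expR (- (9 * ln N%:R)) <= (17 / 18 * u) ^+ 2 / 14 / 3.
Proof.
move=> uE.
have Np : 0 < N%:R :> R by rewrite ltr0n.
have -> : expR (- (9 * ln N%:R)) = (N%:R ^+ 9)^-1 :> R.
  by rewrite expRN expRM_natl lnK// posrE.
have E : N%:R = (N.-1)%:R + 1 :> R by rewrite natr1 prednK.
set k : R := N.-1%:R in E.
have k1 : 1 <= k by rewrite /k ler1n; lia.
have uw : u * (N%:R * k) = 2 / 3.
  by rewrite uE natrM; field; rewrite !gt_eqF//; lra.
(* As [u N (N - 1) = 2 / 3], the right side of the goal is a constant over [(N (N - 1))^2]; 106 is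
   the inverse of that constant, rounded up. For [N = 2] the claim reads [424 <= 512]; for larger
   [N], [106 <= 3^5] suffices. *)
have N9 : 106 * (N%:R * k) ^+ 2 <= N%:R ^+ 9 :> R.
  have [N2|N3] := ltnP N 3.
    have N2' : N = 2%N by lia.
    by rewrite /k N2'/= mulr1 !exprS expr0; lra.
  have N3' : 3 <= N%:R :> R by rewrite ler_nat.
  have kN : k ^+ 2 <= N%:R ^+ 2 by rewrite ler_sqr ?nnegrE; lra.
  have N5 : 3 ^+ 5 <= N%:R ^+ 5 :> R by rewrite lerXn2r ?nnegrE; lra.
  have -> : N%:R ^+ 9 = N%:R ^+ 5 * (N%:R ^+ 2 * N%:R ^+ 2) :> R.
    by rewrite -!exprD.
  rewrite exprMn; apply: ler_pM; rewrite ?mulr_ge0 ?sqr_ge0//.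
    by apply: le_trans N5; rewrite !exprS expr0; lra.
  by rewrite ler_wpM2l ?sqr_ge0.
rewrite -[X in X <= _]mul1r ler_pdivrMr ?exprn_gt0//.
apply: (@le_trans _ _ ((17 / 18 * u) ^+ 2 / 14 / 3 * (106 * (N%:R * k) ^+ 2))).
  have -> : (17 / 18 * u) ^+ 2 / 14 / 3 * (106 * (N%:R * k) ^+ 2) =
     (17 / 18) ^+ 2 / 14 / 3 * 106 * (u * (N%:R * k)) ^+ 2 by ring.
  by rewrite uw !expr2; lra.
by rewrite ler_wpM2l// !divr_ge0// sqr_ge0.
Qed.

Lemma partition_lower :
  ((pair_prod c ^+ N * expR (- (9 * (N%:R * ln N%:R))))%:E <=
   \int[mu]_x (pair_power x)%:E)%E.
Proof.
(* At angle [2 * u] the perturbation bound loses [N (N - 1) u] times the maximum, which this choice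
   makes two thirds of it. *)
pose u : R := 2 / (3 * (N * N.-1)%:R).
have n1 : 2 <= (N * N.-1)%:R :> R by rewrite ler_nat; nia.
have u3 : u <= 1 / 3.
  rewrite /u; move: n1; move: (N * N.-1)%:R => z z2.
  by rewrite ler_pdivrMr; lra.
have u0 : 0 < u by rewrite divr_gt0// mulr_gt0//; apply: lt_le_trans n1.
have uI : 0 < u <= 1 / 3 by rewrite u0.
have pi2 := pi_ge2 R.
pose r : R := (17 / 18 * u) ^+ 2 / 14.
have r0 : 0 <= r by rewrite divr_ge0// sqr_ge0.
pose A i := cap (c i) (2 * u).
pose Q := [set x : N.-tuple (R3 R) | forall i, A i (tnth x i)].
have mA i : measurable (A i) by exact: measurable_cap.
have mQ : measurable Q by exact: measurable_tuple_box.
have Qr : ((r ^+ N)%:E <= mu Q)%E.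
  rewrite /Q power_probability_box//; apply: ler_prod_EFin => // i.
  exact: uniform_sphere_cap.
set M := pair_prod c.
have QM x : Q x -> M / 3 <= pair_prod (tnth x).
  move=> Qx; have aI : 0 <= 2 * u < pi by apply/andP; split; lra.
  have sx i : sphere (tnth x i) by have [] := Qx i.
  have cx i : cos (2 * u) <= dot3 (c i) (tnth x i) by have [] := Qx i.
  have := pair_prod_perturb cmax hN sc sx aI cx.
  apply: le_trans; rewrite -/M /u.
  have -> : (N * N.-1)%:R * M / 2 * (2 * (2 / (3 * (N * N.-1)%:R))) = 2 / 3 * M.
    move: n1; move: (N * N.-1)%:R => z z2.
    by field; rewrite gt_eqF//; lra.
  lra.
apply: (@le_trans _ _ (((M / 3) ^+ N)%:E * mu Q)%E).
  apply: (@le_trans _ _ (((M / 3) ^+ N)%:E * (r ^+ N)%:E)%E); last first.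
    by apply: lee_wpmul2l => //; rewrite lee_fin exprn_ge0// divr_ge0// ltW.
  rewrite -EFinM lee_fin -!exprMn.
  have -> : - (9 * (N%:R * ln N%:R)) = N%:R * - (9 * ln N%:R) :> R by ring.
  rewrite expRM_natl -exprMn lerXn2r ?nnegrE//.
  - by rewrite mulr_ge0 ?expR_ge0// ltW.
  - by rewrite mulr_ge0// divr_ge0// ltW.
  - rewrite -mulrA [_^-1 * _]mulrC (ler_wpM2l (ltW c0))//.
    exact: cap_weight_ge.
rewrite -integral_cst//.
apply: (@le_trans _ _ (\int[mu]_(x in Q) (pair_power x)%:E)%E).
  apply: ge0_le_integral => //.
  - by move=> x _; rewrite lee_fin exprn_ge0// divr_ge0// ltW.
  - by apply: measurable_funTS; apply/measurable_EFinP; exact: measurable_pair_power.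
  - move=> x Qx; rewrite lee_fin lerXn2r ?nnegrE ?pair_prod_ge0// ?QM//.
    by rewrite divr_ge0// ltW.
apply: ge0_subset_integral => //.
- by apply/measurable_EFinP; exact: measurable_pair_power.
- by move=> x _; rewrite lee_fin pair_power_ge0.
Qed.

(** The reference measure lives on all [N]-tuples of vectors, while the maximality of [c] concerns
    the sphere only; the complement is null. *)
Lemma pair_power_le_ae :
  \forall x \ae mu, pair_power x <= pair_prod c ^+ N.
Proof.
exists (~` sphereN R N); split.
- by apply: measurableC; exact: measurable_sphereN.
- exact: power_sphereNC.
- move=> x /= H sx; apply: H.
  by rewrite lerXn2r ?nnegrE ?pair_prod_ge0// cmax.
Qed.

Lemma partition_upper :
  (\int[mu]_x (pair_power x)%:E <= (pair_prod c ^+ N)%:E)%E.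
Proof.
have B0 : 0 <= pair_prod c ^+ N by rewrite exprn_ge0// ltW.
apply: (@le_trans _ _ (\int[mu]_x (cst (pair_prod c ^+ N)%:E x))%E).
  apply: ae_ge0_le_integral => //.
  - by move=> x _; rewrite lee_fin pair_power_ge0.
  - by apply/measurable_EFinP; exact: measurable_pair_power.
  - by apply: filterS pair_power_le_ae => x H _; rewrite lee_fin.
rewrite integral_cst// -[leRHS]mule1; apply: lee_wpmul2l; first by rewrite lee_fin.
exact: probability_le1.
Qed.

Lemma coulomb_gasE (Z : R) (A : set (N.-tuple (R3 R))) : 0 < Z ->
  (\int[mu]_x (pair_power x)%:E = Z%:E)%E ->
  (coulomb_gas N N%:R A = Z^-1%:E * \int[mu]_(x in A) (pair_power x)%:E)%E.
Proof.
move=> Z0 intZ.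
have dE B : (mdensity mu (@measurable_boltzmann R N N%:R) (@boltzmann_ge0 R N N%:R) B
    = \int[mu]_(x in B) (pair_power x)%:E)%E.
  by rewrite /mdensity boltzmann_pair_power.
by rewrite -dE; apply: mnormalizeE => //; rewrite -intZ; exact: dE.
Qed.

End partition_function.

(** * Minimal energy, tail bound and mean bound for the Coulomb gas *)

Theorem corollary1p2 (R : realType) (N : nat) (hN : (2 <= N)%N) :
  exists m : R,
    [/\ is_minimum (sphereN R N) (@log_energy R N) m%:E,
        ((1 - expR (- (N%:R * ln N%:R)))%:E <=
           coulomb_gas N (N%:R : R)
             [set x | sphereN R N x /\
                      (log_energy x - m%:E <= (10 * ln N%:R)%:E)%E])%E
      & ((\int[coulomb_gas N (N%:R : R)]_x log_energy x) - m%:E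
           <= (9 * ln N%:R)%:E)%E].
Proof.
have N0 : (0 < N)%N by exact: ltn_trans hN.
have NR : 0 < N%:R :> R by rewrite ltr0n.
have [c sc cmax] := exists_pair_prod_max N (R := R).
have c0 : 0 < pair_prod c.
  have [d sd d0] := exists_pair_prod_gt0 N (R := R).
  exact: lt_le_trans (cmax d sd).
set M := pair_prod c in cmax c0.
pose mu := power_probability (uniform_sphere R) N.
pose nu := coulomb_gas N (N%:R : R).
pose B := M ^+ N; pose L : R := N%:R * ln N%:R.
have B0 : 0 < B by exact: exprn_gt0.
have := partition_lower hN sc cmax c0; have := partition_upper hN cmax c0.
rewrite -/M -/mu -/B -/L => ZB BZ.
pose Z := fine (\int[mu]_x (pair_power x)%:E)%E.
have intZ : (\int[mu]_x (pair_power x)%:E = Z%:E)%E.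
  rewrite /Z fineK// ge0_fin_numE ?(le_lt_trans ZB) ?ltry//.
  by apply: integral_ge0 => x _; rewrite lee_fin pair_power_ge0.
rewrite intZ !lee_fin in ZB BZ.
have Z0 : 0 < Z by apply: lt_le_trans BZ; rewrite mulr_gt0// expR_gt0.
have nuE A : measurable A ->
    (nu A = Z^-1%:E * \int[mu]_(x in A) (pair_power x)%:E)%E.
  by move=> _; exact: coulomb_gasE.
have mf := measurable_pair_power hN (R := R).
have f0 := @pair_power_ge0 R N.
have mSC : measurable (~` sphereN R N).
  exact: measurableC (@measurable_sphereN R N).
have nuSC : (nu (~` sphereN R N) = 0)%E.
  rewrite nuE// null_set_integral ?mule0//; last exact: power_sphereNC.
  by apply: measurable_funTS; exact/measurable_EFinP.
have lnBZ : ln B - ln Z <= 9 * L.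
  have : ln (B * expR (- (9 * L))) <= ln Z.
    by rewrite ler_ln ?posrE ?mulr_gt0 ?expR_gt0.
  by rewrite lnM ?posrE ?expR_gt0// expRK; lra.
have energyE (x : N.-tuple (R3 R)) : 0 < pair_prod (tnth x) ->
    (log_energy x = (- ln (pair_prod (tnth x)))%:E)%E.
  by move=> x0; rewrite log_energyE gt_eqF.
exists (- ln M); split.
- split.
    exists [tuple c i | i < N].
      by move=> i; rewrite tnth_mktuple.
    have e : tnth [tuple c i | i < N] = c by apply/funext => i; rewrite tnth_mktuple.
    by rewrite energyE e.
  move=> x sx; rewrite log_energyE; case: ifPn => [_|x0]; first by rewrite leey.
  have xp : 0 < pair_prod (tnth x) by rewrite lt_neqAle eq_sym x0 pair_prod_ge0.
  by rewrite lee_fin lerN2 ler_ln// cmax.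
- set G := [set x | _].
  have mG : measurable G.
    rewrite (_ : G = sphereN R N `&`
        (@log_energy R N @^-1` [set y | y <= (10 * ln N%:R - ln M)%:E])%E); last first.
      have E (x : N.-tuple (R3 R)) :
          (log_energy x - (- ln M)%:E <= (10 * ln N%:R)%:E)%E =
          (log_energy x <= (10 * ln N%:R - ln M)%:E)%E.
        by rewrite leeBlDr// -EFinD.
      by apply/seteqP; split => x [sx]; [rewrite E|rewrite /= -E]; split.
    apply: measurableI; first exact: measurable_sphereN.
    rewrite -[X in measurable X]setTI.
    apply: measurable_log_energy => //.
    rewrite (_ : [set y | _] = `]-oo, (10 * ln N%:R - ln M)%:E]%classic); last first.
      by apply/seteqP; split => y; rewrite /= in_itv.
    exact: emeasurable_itv.
  (* On the sphere, [pair_power >= e] means an energy excess of at most [10 ln N]. The Gibbs mass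
     below the level [e] is at most [e / Z], and [Z >= B exp (- 9 L)] turns this into
     [exp (- L)]. *)
  pose e := B * expR (- (10 * L)).
  have e0 : 0 < e by rewrite mulr_gt0// expR_gt0.
  have mA : measurable [set x | (@pair_power R N x < e)%R].
    rewrite (_ : [set x | _] = setT `&` @pair_power R N @^-1` `]-oo, e[%classic).
      by apply: mf => //; exact: measurable_itv.
    by rewrite setTI; apply/seteqP; split => x; rewrite /= in_itv.
  have GC : ~` G `<=` ~` sphereN R N `|` [set x | (pair_power x < e)%R].
    move=> x nG; have [sx|sx] := pselect (sphereN R N x); [right|by left].
    rewrite /= ltNge; apply/negP => ex; apply: nG; split=> //.
    have xN : 0 < pair_power x by exact: lt_le_trans ex.
    have xp : 0 < pair_prod (tnth x).
      by rewrite lt_neqAle pair_prod_ge0 andbT eq_sym; move: xN;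
        rewrite /pair_power; apply: contraTneq => ->; rewrite expr0n gtn_eqF// ltxx.
    rewrite energyE// -EFinB lee_fin.
    have : ln e <= ln (pair_power x) by rewrite ler_ln.
    rewrite /e lnM ?posrE ?expR_gt0// expRK /pair_power /B !lnXn//.
    rewrite -[ln M *+ N]mulr_natl -[ln (pair_prod _) *+ N]mulr_natl /L => H.
    rewrite -(ler_pM2l NR); lra.
  have : (nu (~` G) <= (expR (- L))%:E)%E.
    apply: (@le_trans _ _ (nu (~` sphereN R N `|` [set x | (pair_power x < e)%R]))).
      apply: le_measure => //; rewrite inE; first exact: measurableC.
      exact: measurableU.
    apply: (le_trans (measureU2 nu mSC mA)).
    rewrite [X in (X + _)%E]nuSC add0e.
    have tail := gibbs_tail mf f0 Z0 nuE (ltW e0).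
    apply: (le_trans tail).
    rewrite lee_fin ler_pdivrMr//.
    have -> : e = expR (- L) * (B * expR (- (9 * L))).
      by rewrite /e [RHS]mulrCA -expRD; congr (_ * expR _); ring.
    by rewrite ler_wpM2l// expR_ge0.
  rewrite probability_setC// => H.
  rewrite EFinB leeBlDr// addeC -leeBlDr//.
  by rewrite fin_num_measure.
- have H := gibbs_entropy mf f0 Z0 intZ nuE ZB (pair_power_le_ae cmax).
  pose h := log_gap (@pair_power R N) B.
  have h0 x : 0 <= h x by exact: log_gap_ge0.
  have mh : measurable_fun setT h by exact: measurable_log_gap.
  have ih : nu.-integrable setT (EFin \o h).
    apply/integrableP; split; first exact/measurable_EFinP.
    under eq_integral do rewrite /= ger0_norm//.
    by apply: le_lt_trans H _; rewrite ltry.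
  (* Almost everywhere [h] is [N] times the excess of the energy over its minimum. The possible
     exceptions, off the sphere or where [pair_power] vanishes, are null for [nu]. *)
  have ->: (\int[nu]_x log_energy x =
      \int[nu]_x ((N%:R^-1)%:E * (h x)%:E + cst (- ln M)%:E x))%E.
    apply: ae_eq_integral => //.
    - exact: measurable_log_energy.
    - apply: emeasurable_funD => //; apply: measurable_funeM.
      exact/measurable_EFinP.
    pose V := [set x | (@pair_power R N x <= 0)%R].
    have mV : measurable V.
      rewrite (_ : V = setT `&` @pair_power R N @^-1` `]-oo, 0]%classic).
        by apply: mf => //; exact: measurable_itv.
      by rewrite setTI; apply/seteqP; split => x; rewrite /= in_itv.
    have nuV : (nu V = 0)%E.
      rewrite nuE// integral0_eq ?mule0// => x Vx.
      by congr EFin; apply/le_anti; rewrite f0 andbT.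
    exists (~` sphereN R N `|` V); split.
    - exact: measurableU.
    - apply/eqP; rewrite eq_le measure_ge0 andbT.
      apply: (le_trans (measureU2 nu mSC mV)).
      by rewrite [X in (X + _)%E]nuSC add0e [X in (X <= _)%E]nuV.
    move=> x; apply: contra_notP => /not_orP[/contrapT sx /negP].
    rewrite /= -ltNge => xN _.
    have xp : 0 < pair_prod (tnth x).
      by rewrite lt_neqAle pair_prod_ge0 andbT eq_sym; move: xN;
        rewrite /pair_power; apply: contraTneq => ->; rewrite expr0n gtn_eqF// ltxx.
    rewrite energyE// -EFinM -EFinD; congr EFin.
    have -> : h x = N%:R * (ln M - ln (pair_prod (tnth x))).
      rewrite /h /log_gap xN /= lerXn2r ?nnegrE ?pair_prod_ge0 ?(ltW c0) ?cmax//.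
      by rewrite /B /pair_power !lnXn// -mulrnBl mulr_natl.
    by rewrite mulKf ?gt_eqF//; lra.
  have iN : nu.-integrable setT (fun x => (N%:R^-1)%:E * (h x)%:E)%E.
    exact: integrableZl.
  rewrite integralD//; last exact: finite_measure_integrable_cst.
  rewrite integral_cst// [X in (_ + _ * X - _)%E](_ : _ = 1%E) ?mule1; last first.
    exact: probability_setT.
  rewrite addeK// integralZl//.
  apply: (@le_trans _ _ ((N%:R^-1)%:E * (9 * L)%:E)%E).
    apply: lee_wpmul2l; first by rewrite lee_fin invr_ge0 ltW.
    by apply: le_trans H _; rewrite lee_fin.
  by rewrite -EFinM lee_fin /L mulrCA mulKf ?gt_eqF.
Qed.
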